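(* Let $M$ be a nonlinear twice differentiable hypersurface in $\mathbb{R}^{n+1}$. If $\mathscr{A}$ is a family of (affine) hyperplanes in $\mathbb{R}^{n+1}$ such that $\bigcup \mathscr{A} \supseteq M$, then $\dim_{\mathcal{H}} \bigcup \mathscr{A} = n+1$.
   Context: A topological $d$-submanifold of $\mathbb{R}^N$ is a topological subspace $M\subseteq\mathbb{R}^N$ that is a topological $d$-manifold in the induced topology; all manifolds are assumed connected. A hypersurface is a submanifold of codimension $1$. $M$ is called twice differentiable iff for every $p\in M$, in a neighbourhood of $p$ the set $M$ coincides (up to a rigid motion) with the graph of a twice differentiable map (the second derivative need not be continuous). A submanifold $M$ of $\mathbb{R}^N$ is linear iff there is an affine subspace $\Pi\subseteq\mathbb{R}^N$ such that $M$ is an open subset of $\Pi$; otherwise it is nonlinear. $\dim_{\mathcal{H}}$ denotes Hausdorff dimension, and $\bigcup\mathscr{A}$ is the union of all members of $\mathscr{A}$. *)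

(* Defs.v *)
From HB Require Import structures.
From mathcomp Require Import all_boot all_order all_algebra.
From mathcomp Require Import all_classical all_reals all_analysis.

Set Implicit Arguments.
Unset Strict Implicit.
Unset Printing Implicit Defensive.

Import Order.TTheory GRing.Theory Num.Theory.
Import numFieldNormedType.Exports.

Local Open Scope classical_set_scope.
Local Open Scope ring_scope.

(* R^N is 'rV[R]_N. Its library norm is the sup norm; this is immaterial for
   the topology and for (Frechet) differentiability, but diameters below are
   taken with respect to the Euclidean norm. *)

Definition enorm (R : realType) (N : nat) (x : 'rV[R]_N) : R :=
  Num.sqrt (\sum_(i < N) x ord0 i ^+ 2).

(* The extra point 0 only serves to give the empty set diameter 0 instead
   of -oo. *)
Definition ediam (R : realType) (N : nat) (U : set 'rV[R]_N) : \bar R :=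
  ereal_sup (0%E |` [set (enorm (p.1 - p.2))%:E | p in U `*` U]).

(* diam(U)^s, with the usual conventions that the empty set weighs 0, and a
   nonempty set weighs 1 when s = 0. *)
Definition hausdorff_weight (R : realType) (N : nat) (s : R)
    (U : set 'rV[R]_N) : \bar R :=
  if U == set0 then 0%E else poweR (ediam U) s.

Definition hausdorff_premeasure (R : realType) (N : nat) (s delta : R)
    (A : set 'rV[R]_N) : \bar R :=
  ereal_inf [set (\sum_(0 <= k <oo) hausdorff_weight s (U k))%E
    | U in [set U : nat -> set 'rV[R]_N |
             (forall k, (ediam (U k) <= delta%:E)%E)
             /\ A `<=` \bigcup_k U k]].

Definition hausdorff_measure (R : realType) (N : nat) (s : R)
    (A : set 'rV[R]_N) : \bar R :=
  ereal_sup [set hausdorff_premeasure s delta A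
    | delta in [set delta : R | 0 < delta]].

Definition hausdorff_dim (R : realType) (N : nat)
    (A : set 'rV[R]_N) : \bar R :=
  ereal_inf [set s%:E
    | s in [set s : R | 0 <= s /\ hausdorff_measure s A = 0%E]].

Definition affine_subspace (R : realType) (N d : nat)
    (P : set 'rV[R]_N) : Prop :=
  exists (a : 'rV[R]_N) (V : {vspace 'rV[R]_N}),
    \dim V = d /\ P = [set a + v | v in [set v | v \in V]].

Definition hyperplane (R : realType) (n : nat)
    (H : set 'rV[R]_(n + 1)) : Prop :=
  affine_subspace n H.

Definition homeomorphic_sets (S T : topologicalType)
    (A : set S) (B : set T) : Prop :=
  exists (phi : S -> T) (psi : T -> S),
    [/\ {within A, continuous phi}, {within B, continuous psi},
        (forall x, A x -> B (phi x) /\ psi (phi x) = x) &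
        (forall y, B y -> A (psi y) /\ phi (psi y) = y)].

(* Hausdorffness and second countability are inherited from R^N, so only
   connectedness and the existence of local charts are required. *)
Definition topological_submanifold (R : realType) (N d : nat)
    (M : set 'rV[R]_N) : Prop :=
  connected M /\
  forall p, M p -> exists (V : set 'rV[R]_N) (W : set 'rV[R]_d),
    [/\ open V, V p, open W & homeomorphic_sets (M `&` V) W].

Definition hypersurface (R : realType) (n : nat)
    (M : set 'rV[R]_(n + 1)) : Prop :=
  topological_submanifold n M.

(* The derivative x |-> 'd f x is represented by the matrix-valued map
   jacobian f; its own derivative need not be continuous. *)
Definition twice_differentiable_on (R : realType) (d k : nat)
    (U : set 'rV[R]_d) (f : 'rV[R]_d -> 'rV[R]_k) : Prop :=
  forall x, U x -> differentiable f x /\ differentiable (jacobian f) x.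

Definition rigid_motion (R : realType) (N : nat)
    (g : 'rV[R]_N -> 'rV[R]_N) : Prop :=
  exists (Q : 'M[R]_N) (c : 'rV[R]_N),
    Q *m Q^T = 1%:M /\ g = (fun x => x *m Q + c).

Definition graph_over (R : realType) (d k : nat)
    (U : set 'rV[R]_d) (f : 'rV[R]_d -> 'rV[R]_k) : set 'rV[R]_(d + k) :=
  [set row_mx x (f x) | x in U].

Definition twice_differentiable_set (R : realType) (d k : nat)
    (M : set 'rV[R]_(d + k)) : Prop :=
  forall p, M p ->
    exists (V : set 'rV[R]_(d + k)) (g : 'rV[R]_(d + k) -> 'rV[R]_(d + k))
           (U : set 'rV[R]_d) (f : 'rV[R]_d -> 'rV[R]_k),
      [/\ open V /\ V p, rigid_motion g, open U,
          twice_differentiable_on U f &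
          M `&` V = (g @` graph_over U f) `&` V].

Definition linear_set (R : realType) (N : nat) (M : set 'rV[R]_N) : Prop :=
  exists (d : nat) (P O : set 'rV[R]_N),
    [/\ affine_subspace d P, open O & M = P `&` O].

(* Main.v *)
Require Import Defs.
From HB Require Import structures.
From mathcomp Require Import all_boot all_order all_algebra.
From mathcomp Require Import all_classical all_reals all_analysis.
From mathcomp Require Import measurable_realfun.
From mathcomp Require Import ring lra zify.

Set Implicit Arguments.
Unset Strict Implicit.
Unset Printing Implicit Defensive.

Import Order.TTheory GRing.Theory Num.Theory.
Import numFieldNormedType.Exports.

Local Open Scope classical_set_scope.
Local Open Scope ring_scope.

(** Write E for the union of the hyperplanes.  Counting dyadic cubes shows that
    every subset of R^N has dimension at most N ([hausdorff_null_above_dim]), so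
    the point is that H^s(E) = 0 is impossible for s < n + 1.

    _Reduction to a plane curve._  As M is connected and nonlinear, it has a
    chart in which it is the graph of a function f that fails to be affine along
    some segment from x0 to x0 + v ([nonlinear_chart]); otherwise M would
    coincide near each of its points with the tangent hyperplane there, and by
    connectedness these hyperplanes would all be the same
    ([locally_flat_linear]).  Failing to be affine along a segment is stable
    under small translations of the segment.  If H^s(E) = 0, where s may be
    increased so as to be at least 1, there is a sequence of dyadic cells of
    sizes 2^-j_k such that the sum of the 2^(-s j_k) is finite and each point of
    E lies in cells of arbitrarily small size ([hausdorff_null_cells]).  By Fubini, fixing one coordinate at a
    suitable value near a prescribed one gives cells of the slice for which the
    exponent has dropped by one ([slice_budget]).  Fixing n - 1 coordinates
    transversal to v leaves a plane with coordinates (u, z), in which the trace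
    of M contains a twice differentiable curve z = phi(u) that is not affine,
    the trace of E contains, through each point of the curve, a line (a
    hyperplane meets a plane through one of its points at least in a line), and
    the cells have an exponent smaller than 2.

    _Lines in the plane._  The main estimate
    ([separated_lines_negligible]) concerns lines z = a_x u + b_x, indexed by
    x in D, whose parameters are separated:
    c |x - y| <= |a_x - a_y| + |b_x - b_y|.  If all of them are covered by
    cells with an exponent smaller than 2, then D is Lebesgue null.  This is an
    L^2 argument in the style of Cordoba's Kakeya bound.  For infinitely many
    scales j, a given line is covered at scale j above a set of abscissas of
    measure at least omega^j in the unit interval, with omega < 1 fixed.  For
    each j choose one such line per dyadic interval of indices of length 2^-j;
    two chosen lines whose
    indices are d intervals apart are within 2^-j of each other only on a set
    of measure O(1/d), so the number of pairs of lines in a common cell is, on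
    average, almost proportional to the number N of lines.  By the
    arithmetic-geometric mean inequality, the lines then need so many cells
    that N 2^-j is summable in j ([incidence_bound]), and the Borel-Cantelli
    lemma concludes.

    _End of the proof._  The line through a point of the curve is vertical,
    transversal to the curve, or tangent to it.  The abscissas of points of the
    first two kinds form a null set, since abscissas are separated parameters
    for these lines; the slopes of the tangent lines of the third kind also
    form a null set, because a slope is a separated parameter.  The
    differentiable function phi' maps null sets to null sets.  Thus the image
    of phi' is null; by the intermediate value theorem, phi' is constant
    ([curve_not_coverable]), and phi is affine, a contradiction. *)

(** * Incidences between points and cells *)

(** The integer coordinates of the half-open dyadic cube of side 2^-j that
    contains the point with coordinates p. *)
Definition cell (R : realType) (j : nat) (p : seq R) : seq int :=
  [seq Num.floor (2 ^+ j * t) | t <- p].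

(** Above a fixed abscissa, let m_c be the number of points (indexed by S) in the
    cell c.  Summing m_c <= lam + m_c^2 / lam over the cells of Q in the column h
    bounds the number of points in Q by the number of cells and the number of
    pairs of points that share a cell. *)
Lemma incidence_pointwise (R : realType) (Q : seq (seq int)) (S : seq nat)
    (h : int) (g : nat -> int) (lam : R) :
  uniq Q -> 0 < lam ->
  \sum_(i <- S) ([:: h; g i] \in Q)%:R <=
    lam * (\sum_(c <- Q) (ohead c == Some h)%:R) +
    lam^-1 * (\sum_(i <- S) \sum_(k <- S) (g i == g k)%:R).
Proof.
move=> uQ lam0.
pose m c : R := \sum_(i <- S) ([:: h; g i] == c)%:R.
have -> : \sum_(i <- S) ([:: h; g i] \in Q)%:R = \sum_(c <- Q) m c.
  rewrite exchange_big /=; apply: eq_bigr => i _.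
  by rewrite -(count_uniq_mem _ uQ) -sum1_count natr_sum big_mkcond /=;
    apply: eq_bigr => c _; rewrite /= eq_sym; case: eqP.
have m0 c : 0 <= m c by apply: sumr_ge0 => i _; exact: ler0n.
have step c : m c <= lam * (ohead c == Some h)%:R + lam^-1 * (m c ^+ 2).
  have [/eqP e|ne] := boolP (ohead c == Some h).
    rewrite mulr1 -(ler_pM2l lam0) mulrDr mulrA divff ?gt_eqF// mul1r.
    rewrite -subr_ge0; have -> : lam * lam + m c ^+ 2 - lam * m c =
      (lam - m c / 2) ^+ 2 + 3 / 4 * m c ^+ 2 by field.
    by rewrite addr_ge0 ?sqr_ge0// mulr_ge0 ?sqr_ge0//; lra.
  have -> : m c = 0.
    rewrite /m big1// => i _; case: eqP => // e.
    by move: ne; rewrite -e /= eqxx.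
  by rewrite mulr0 expr0n mulr0 addr0.
apply: (le_trans (ler_sum _ (fun c _ => step c))).
rewrite big_split /= -!mulr_sumr lerD2l ler_pM2l ?invr_gt0//.
rewrite (eq_bigr (fun c => \sum_(i <- S) \sum_(k <- S)
    (([:: h; g i] == c)%:R * ([:: h; g k] == c)%:R))); last first.
  move=> c _; rewrite expr2 /m mulr_suml; apply: eq_bigr => i _.
  by rewrite mulr_sumr.
rewrite exchange_big /=; apply: ler_sum => i _.
rewrite exchange_big /=; apply: ler_sum => k _.
have [e|ne] := eqVneq (g i) (g k).
  rewrite -e; apply: (@le_trans _ _ ([:: h; g i] \in Q)%:R); last first.
    by case: (_ \in _).
  rewrite -(count_uniq_mem _ uQ) -sum1_count natr_sum [leRHS]big_mkcond /=.
  by apply: ler_sum => c _; rewrite /= [c == _]eq_sym; case: eqP => _;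
    rewrite ?mulr1 ?mulr0.
rewrite big1// => c _; case: eqP => [e1|]; rewrite ?mul0r ?mulr0//.
case: eqP => [e2|]; rewrite ?mul0r ?mulr0//.
by move: ne; move: e1; rewrite -e2 => -[->]; rewrite eqxx.
Qed.

Lemma harmonic_pow2 (R : realType) (j : nat) :
  \sum_(0 <= k < 2 ^ j) (k.+1%:R^-1 : R) <= j.+1%:R.
Proof.
elim: j => [|j IH]; first by rewrite expn0 big_nat1 invr1.
have le2 : (2 ^ j <= 2 ^ j.+1)%N by rewrite leq_exp2l.
rewrite (big_cat_nat (leq0n _) le2)/= -[in leRHS]natr1 lerD//.
have e1 : \sum_(2 ^ j <= k < 2 ^ j.+1) (2 ^ j)%:R^-1 = 1 :> R.
  rewrite big_const_nat expnS mul2n -addnn addnK iter_addr addr0.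
  by rewrite -[LHS]mulr_natr mulVf// pnatr_eq0 expn_eq0.
rewrite -[leRHS]e1 !big_nat; apply: ler_sum => k /andP[k1 _].
by rewrite lef_pV2 ?posrE ?ltr0n ?expn_gt0// ler_nat ltnW.
Qed.

(** The weights decay like the inverse of the distance to i, so their sum is
    bounded by two harmonic sums. *)
Lemma harmonic_distance (R : realType) (j : nat) (S : seq nat) (i : nat)
    (w : nat -> R) (K : R) : uniq S -> (forall k, k \in S -> (k < 2 ^ j)%N) ->
  0 <= K -> (i < 2 ^ j)%N -> (forall k, k \in S -> w k <= 1) ->
  (forall k, k \in S -> k != i -> w k <= K / (`|k%:R - i%:R|)) ->
  \sum_(k <- S) w k <= (1 + 2 * K) * j.+1%:R.
Proof.
move=> uS Sj K0 ij w1 wK.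
pose v k : R := if k == i then 1 else K / (`|k%:R - i%:R|).
have v0 k : 0 <= v k by rewrite /v; case: ifP => // _; rewrite divr_ge0.
apply: (@le_trans _ _ (\sum_(k <- S) v k)).
  rewrite !big_seq; apply: ler_sum => k kS; rewrite /v.
  by have [|] := eqVneq k i; [rewrite w1|move=> ?; exact: wK].
apply: (@le_trans _ _ (\sum_(0 <= k < 2 ^ j) v k)).
  have <- : \sum_(k <- [seq k <- index_iota 0 (2 ^ j) | k \in S]) v k =
      \sum_(k <- S) v k.
    apply: perm_big; apply: uniq_perm => //.
      by rewrite filter_uniq// iota_uniq.
    move=> k; rewrite mem_filter mem_index_iota leq0n /=.
    by case: (boolP (k \in S)) => //= /Sj ->.
  rewrite big_filter [leRHS](bigID (mem S)) /=.
  by rewrite lerDl sumr_ge0.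
rewrite (big_cat_nat (leq0n i) (ltnW ij))/=.
rewrite (big_ltn ij) {2}/v eqxx.
have H := harmonic_pow2 R j.
have L1 : \sum_(0 <= k < i) v k <= K * j.+1%:R.
  apply: le_trans (ler_wpM2l K0 H); rewrite big_nat_rev /= add0n.
  rewrite mulr_sumr (big_cat_nat (leq0n i) (ltnW ij))/=.
  rewrite -[leLHS]addr0 lerD//; last first.
    by apply: sumr_ge0 => k _; rewrite divr_ge0.
  rewrite !big_nat; apply: ler_sum => k /andP[_ ki]; rewrite /v ifF; last first.
    by apply/negbTE; rewrite neq_ltn; apply/orP; left; lia.
  rewrite ler_wpM2l// lef_pV2 ?posrE ?ltr0Sn// ?normr_gt0 ?subr_eq0 ?eqr_nat; last by lia.
  by rewrite distrC -natrB ?normr_nat ?ler_nat; lia.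
have L2 : \sum_(i.+1 <= k < 2 ^ j) v k <= K * j.+1%:R.
  apply: le_trans (ler_wpM2l K0 H).
  rewrite mulr_sumr (big_cat_nat (leq0n _) (leq_subr i.+1 _))/=.
  rewrite -[leLHS]addr0 lerD//; last first.
    by apply: sumr_ge0 => k _; rewrite divr_ge0.
  rewrite -{1}[i.+1]add0n big_addn.
  rewrite !big_nat; apply: ler_sum => k /andP[_ ki]; rewrite /v ifF; last first.
    by apply/negbTE; rewrite neq_ltn; apply/orP; right; lia.
  rewrite ler_wpM2l// lef_pV2 ?posrE ?ltr0Sn// ?normr_gt0 ?subr_eq0 ?eqr_nat; last by lia.
  by rewrite -natrB ?normr_nat ?ler_nat; lia.
have J1 : (1 : R) <= j.+1%:R by rewrite ler1n.
by move: L1 L2 J1; set x := \sum_(_ <= _ < _) _; set y := \sum_(_ <= _ < _) _; lra.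
Qed.

(** * Incidences between separated lines and cells *)

Lemma measurable_affine_preimage (R : realType) (a b : R) (i : interval R) :
  measurable [set u : R | a * u + b \in i].
Proof.
have mf : measurable_fun [set: R] (fun u : R => a * u + b).
  apply: continuous_measurable_fun => x.
  by apply: cvgD; [apply: cvgMr; exact: cvg_id|exact: cvg_cst].
have := mf measurableT _ (measurable_itv i).
by rewrite setTI.
Qed.

Lemma floor_eq_itv (R : realType) (x : R) (h : int) :
  (Num.floor x == h) = (x \in `[h%:~R, (h + 1)%:~R[).
Proof. by rewrite in_itv /= floor_eq intrD1. Qed.

Lemma measurable_floor_affine (R : realType) (a b : R) (h : int) :
  measurable [set u : R | Num.floor (a * u + b) == h].
Proof.
under eq_set do rewrite floor_eq_itv.
exact: measurable_affine_preimage.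
Qed.

Lemma lebesgue_floor_slab (R : realType) (j : nat) (h : int) :
  (lebesgue_measure [set u : R | Num.floor (2 ^+ j * u) == h] =
    ((2 ^+ j)^-1)%:E)%E.
Proof.
have p0 : (0 : R) < 2 ^+ j by rewrite exprn_gt0.
have -> : [set u : R | Num.floor (2 ^+ j * u) == h] =
    `[h%:~R / 2 ^+ j, (h + 1)%:~R / 2 ^+ j[%classic.
  apply/seteqP; split => u /=; rewrite floor_eq_itv !in_itv /=;
    by rewrite ler_pdivrMr// ltr_pdivlMr// [_ * u]mulrC.
rewrite lebesgue_measure_itv /= lte_fin ltr_pM2r ?invr_gt0// ltr_int.
rewrite ltrDl ltr01.
by rewrite -EFinB -mulrBl intrD addrAC subrr add0r mul1r.
Qed.

(** If |b| >= 2 |a|, the strip meets the unit interval only when |a| + |b| <= 3;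
    otherwise it is an interval of length 2 / |a| <= 6 / (|a| + |b|). *)
Lemma lebesgue_strip_le (R : realType) (a b : R) : 0 < `|a| + `|b| ->
  (lebesgue_measure ([set u : R | (a * u + b)%R \in `[(-1)%R, 1%R]] `&` `[0%R, 1%R]) <=
    (6 / (`|a| + `|b|))%:E)%E.
Proof.
move=> ab0.
have mA : measurable ([set u : R | a * u + b \in `[-1, 1]] `&` `[0%R, 1%R]).
  by apply: measurableI => //; exact: measurable_affine_preimage.
have [ba|ab] := leP (2 * `|a|) `|b|.
  have [->|/set0P[u [/= hu]]] := eqVneq
    ([set u : R | a * u + b \in `[-1, 1]] `&` `[0%R, 1%R]) set0.
    by rewrite measure0 lee_fin divr_ge0// ltW.
  rewrite in_itv /= => /andP[u0 u1].
  apply: (@le_trans _ _ (lebesgue_measure (`[0%R, 1%R]%classic : set R))).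
    by apply: le_measure; rewrite ?inE//; exact: measurable_itv.
  rewrite lebesgue_measure_itv /= lte_fin ltr01 oppr0 adde0 lee_fin.
  rewrite ler_pdivlMr// mul1r.
  have : `|b| <= `|a * u + b| + `|a|.
    rewrite {1}(_ : b = (a * u + b) - a * u); last by ring.
    rewrite (le_trans (ler_normB _ _))// lerD2l normrM (ger0_norm u0).
    by rewrite -[leRHS]mulr1 ler_wpM2l.
  have : `|a * u + b| <= 1 by rewrite ler_norml; move: hu; rewrite in_itv.
  by have := normr_ge0 a; lra.
have a0 : a != 0.
  by apply/eqP => a0; move: ab; rewrite a0 normr0 mulr0 normr_lt0.
have na0 : 0 < `|a| by rewrite normr_gt0.
apply: (@le_trans _ _ (lebesgue_measure (closed_ball (- b / a) `|a|^-1))).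
  apply: le_measure; rewrite ?inE//.
    exact: measurable_closed_ball.
  move=> u [/= hu _]; rewrite closed_ballE ?invr_gt0// /closed_ball_ /=.
  rewrite distrC -(ler_pM2l na0) divff ?gt_eqF// -normrM mulrBr mulNr mulrN.
  rewrite mulrCA divff// mulr1 opprK ler_norml.
  by move: hu; rewrite in_itv.
rewrite lebesgue_measure_closed_ball ?invr_ge0// lee_fin.
rewrite ler_pdivlMr// mulr2n mulrDl.
have : `|a|^-1 * (`|a| + `|b|) <= 3 by rewrite ler_pdivrMl//; lra.
by lra.
Qed.

Definition hits (R : realType) (j : nat) (Q : seq (seq int)) (a b : R) :
  set R := [set u | 0 <= u <= 1 /\ cell j [:: u; a * u + b] \in Q].

Lemma measurable_hits (R : realType) j Q (a b : R) : measurable (hits j Q a b).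
Proof.
have -> : hits j Q a b = `[0%R, 1%R]%classic `&`
  [set u | cell j [:: u; a * u + b] \in Q].
  by apply/seteqP; split => u; rewrite /hits /= in_itv.
apply: measurableI => //; elim: Q => [|c Q IH].
  by under eq_set do rewrite in_nil; rewrite set_false; exact: measurable0.
have -> : [set u | cell j [:: u; a * u + b] \in c :: Q] =
   [set u | cell j [:: u; a * u + b] == c] `|`
   [set u | cell j [:: u; a * u + b] \in Q].
  apply/seteqP; split => u /=; rewrite inE.
    by move/orP.
  by move=> ?; apply/orP.
apply: measurableU => //.
case: c => [|h [|k [|? ?]]]; try
  (by under eq_set do rewrite /cell /= ?eqseq_cons /= ?andbF;
   rewrite set_false; exact: measurable0).
have -> : [set u : R | cell j [:: u; a * u + b] == [:: h; k]] =
   [set u | Num.floor (2 ^+ j * u + 0) == h] `&`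
   [set u | Num.floor ((2 ^+ j * a) * u + 2 ^+ j * b) == k].
  apply/seteqP; split => u; rewrite /cell /= !eqseq_cons andbT addr0 mulrDr mulrA.
    by move/andP.
  by move=> ?; apply/andP.
by apply: measurableI; exact: measurable_floor_affine.
Qed.

Definition slab (R : realType) (j : nat) (q : seq int) :
    set (measurableTypeR R) :=
  [set u | ohead q == Some (Num.floor (2 ^+ j * u))].

Lemma slabE (R : realType) (j : nat) (q : seq int) :
  @slab R j q = if q is h :: _ then [set u | Num.floor (2 ^+ j * u) == h]
    else set0.
Proof.
case: q => [|h q]; apply/seteqP; split => u; rewrite /slab //= => /eqP.
  by case=> ->.
by move=> ->.
Qed.

Lemma measurable_slab (R : realType) (j : nat) (q : seq int) :
  measurable (@slab R j q).
Proof.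
rewrite slabE; case: q => [|h q]; first exact: measurable0.
have -> : [set u : R | Num.floor (2 ^+ j * u) == h] =
    [set u | Num.floor (2 ^+ j * u + 0) == h].
  by apply/seteqP; split => u /=; rewrite addr0.
exact: measurable_floor_affine.
Qed.

Lemma lebesgue_slab_le (R : realType) (j : nat) (q : seq int)
    (D : set (measurableTypeR R)) : measurable D ->
  (lebesgue_measure (@slab R j q `&` D) <= ((2 ^+ j)^-1)%:E)%E.
Proof.
move=> mD; apply: (@le_trans _ _ (lebesgue_measure (@slab R j q))).
  apply: le_measure; rewrite ?inE//; last exact: measurable_slab.
  by apply: measurableI => //; exact: measurable_slab.
rewrite slabE; case: q => [|h q]; last by rewrite lebesgue_floor_slab.
by rewrite measure0 lee_fin invr_ge0 exprn_ge0.
Qed.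

Lemma integral_sum_indic (R : realType) (I : Type) (s : seq I)
    (D : set (measurableTypeR R)) (A : I -> set (measurableTypeR R)) (w : I -> R) :
  measurable D ->
  (forall i, measurable (A i)) -> (forall i, 0 <= w i) ->
  (\int[lebesgue_measure]_(u in D) (\sum_(i <- s) w i * \1_(A i) u)%:E =
    \sum_(i <- s) (w i)%:E * lebesgue_measure (A i `&` D))%E.
Proof.
move=> mD mA w0.
under eq_integral do rewrite -sumEFin.
rewrite ge0_integral_sum//.
- apply: eq_bigr => i _; under eq_integral do rewrite EFinM.
  rewrite ge0_integralZl_EFin//.
    by rewrite integral_indic.
  + by apply/measurable_EFinP; exact: measurable_indic.
- move=> i; apply/measurable_EFinP; apply: measurable_funM => //.
- by move=> i x _; rewrite lee_fin mulr_ge0.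
Qed.

Lemma natr_dist (R : realType) (k i : nat) : k != i ->
  exists2 m, (0 < m)%N & `|k%:R - i%:R| = m%:R :> R.
Proof.
wlog ik : i k / (i <= k)%N.
  move=> W ki; have [ik|/ltnW ik] := leqP i k; first exact: W.
  by rewrite distrC; apply: W => //; rewrite eq_sym.
move=> ki; exists (k - i)%N; last by rewrite -natrB// normr_nat.
by rewrite subn_gt0 ltn_neqAle eq_sym ki.
Qed.

(** Integrate [incidence_pointwise] over the unit interval.  On the left each line
    contributes at least omega.  On the right a cell contributes at most its width
    2^-j, and by [lebesgue_strip_le] a pair of lines with indices i and k
    contributes O(1 / |i - k|), whence the harmonic factor j + 1. *)
Lemma incidence_bound (R : realType) (j : nat) (Q : seq (seq int))
    (S : seq nat) (a b : nat -> R) (c omega lam : R) :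
  uniq Q -> uniq S -> (forall k, k \in S -> (k < 2 ^ j)%N) ->
  0 < c -> 0 < lam ->
  (forall i k, i \in S -> k \in S ->
    c * (`|k%:R - i%:R| - 1) <= 2 ^+ j * (`|a i - a k| + `|b i - b k|)) ->
  (forall i, i \in S ->
    (omega%:E <= lebesgue_measure (hits j Q (a i) (b i)))%E) ->
  (size S)%:R * omega <= lam * (size Q)%:R / 2 ^+ j +
    lam^-1 * (size S)%:R * ((1 + 2 * (1 + 12 / c)) * j.+1%:R).
Proof.
move=> uQ uS Sj c0 lam0 sep om.
have p0 : (0 : R) < 2 ^+ j by rewrite exprn_gt0.
pose D : set (measurableTypeR R) := `[0%R, 1%R]%classic.
have mD : measurable D by exact: measurable_itv.
have DE u : D u = (0 <= u <= 1) by rewrite /D /= in_itv.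
have D1 : lebesgue_measure D = 1%E.
  by rewrite lebesgue_measure_itv /= lte_fin ltr01 oppr0 adde0.
pose strip (ik : nat * nat) : set (measurableTypeR R) := [set u |
  2 ^+ j * (a ik.1 - a ik.2) * u + 2 ^+ j * (b ik.1 - b ik.2) \in `[(-1)%R, 1%R]].
have mstrip ik : measurable (strip ik) by exact: measurable_affine_preimage.
(* One weighted family of sets for both sums on the right-hand side: cells with
   weight lam, pairs of lines with weight 1 / lam. *)
pose A (x : seq int + nat * nat) := match x with inl q => @slab R j q | inr ik => strip ik end.
pose w (x : seq int + nat * nat) := match x with inl _ => lam | inr _ => lam^-1 end.
pose s := [seq inl q | q <- Q] ++ [seq inr (i, k) | i <- S, k <- S].
have mA x : measurable (A x).
  by case: x => [q|ik]; [exact: measurable_slab|exact: mstrip].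
have impl (x y : bool) : (x -> y) -> (x%:R : R) <= y%:R.
  by case: x; case: y => //= /(_ isT).
have w0 x : 0 <= w x by case: x => _ /=; rewrite ?invr_ge0 ltW.
have key : (\sum_(i <- S) 1%:E * lebesgue_measure (hits j Q (a i) (b i) `&` D) <=
   \sum_(x <- s) (w x)%:E * lebesgue_measure (A x `&` D))%E.
  rewrite -(integral_sum_indic s mD mA w0).
  rewrite -(@integral_sum_indic _ _ S D (fun i => hits j Q (a i) (b i)) (fun=> 1))//;
    last by move=> i; exact: measurable_hits.
  apply: ge0_le_integral => //.
  - by move=> u _; rewrite lee_fin sumr_ge0// => i _; rewrite mulr_ge0.
  - apply/measurable_EFinP; apply: measurable_sum => i.
    apply: measurable_funM => //; apply: measurable_indic.
    exact: measurable_hits.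
  - apply/measurable_EFinP; apply: measurable_sum => i.
    by apply: measurable_funM => //; exact: measurable_indic.
  - move=> u Du; rewrite lee_fin.
    have := incidence_pointwise S (Num.floor (2 ^+ j * u))
       (fun i => Num.floor (2 ^+ j * (a i * u + b i))) uQ lam0.
    rewrite big_cat big_map big_allpairs_dep /= !mulr_sumr => H.
    apply: le_trans (le_trans H _); last rewrite lerD//.
    + apply: ler_sum => i _; rewrite mul1r indicE; apply: impl.
      by rewrite inE => -[_ H']; exact: H'.
    + apply: ler_sum => q _; rewrite ler_pM2l// indicE; apply: impl => e.
      by rewrite inE.
    + apply: ler_sum => i _; rewrite mulr_sumr.
      apply: ler_sum => k _; rewrite ler_pM2l ?invr_gt0// indicE.
      apply: impl => /eqP e.
      rewrite mem_set// /strip /= in_itv /=.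
      have := floor_itv (2 ^+ j * (a i * u + b i)).
      have := floor_itv (2 ^+ j * (a k * u + b k)).
      rewrite e !intrD1; set n := (_ %:~R); move=> /andP[h1 h2] /andP[h3 h4].
      have -> : 2 ^+ j * (a i - a k) * u + 2 ^+ j * (b i - b k) =
         2 ^+ j * (a i * u + b i) - 2 ^+ j * (a k * u + b k) by ring.
      by apply/andP; lra.
have lhs : (((size S)%:R * omega)%:E <=
    \sum_(i <- S) 1%:E * lebesgue_measure (hits j Q (a i) (b i) `&` D))%E.
  have -> : (size S)%:R * omega = \sum_(i <- S) omega.
    by rewrite big_const_seq count_predT iter_addr addr0 mulr_natl.
  rewrite -sumEFin !big_seq; apply: lee_sum => i iS; rewrite mul1e.
  rewrite (_ : _ `&` D = hits j Q (a i) (b i)) ?om//.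
  by apply/setIidPl => u [+ _]; rewrite DE.
rewrite -lee_fin; apply: (le_trans lhs); apply: (le_trans key).
rewrite big_cat big_map big_allpairs_dep /= EFinD leeD//.
  have -> : lam * (size Q)%:R / 2 ^+ j = \sum_(q <- Q) (lam * (2 ^+ j)^-1).
    by rewrite big_const_seq count_predT iter_addr addr0 -[RHS]mulr_natr mulrAC.
  rewrite -sumEFin; apply: lee_sum => q _.
  rewrite EFinM lee_pmul2l ?lte_fin//.
  exact: lebesgue_slab_le.
have -> : lam^-1 * (size S)%:R * ((1 + 2 * (1 + 12 / c)) * j.+1%:R) =
    \sum_(i <- S) (lam^-1 * ((1 + 2 * (1 + 12 / c)) * j.+1%:R)).
  by rewrite big_const_seq count_predT iter_addr addr0 -[RHS]mulr_natr mulrAC.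
rewrite -sumEFin !big_seq; apply: lee_sum => i iS.
pose v k := fine (lebesgue_measure (strip (i, k) `&` D)).
have vE k : lebesgue_measure (strip (i, k) `&` D) = (v k)%:E.
  rewrite fineK// ge0_fin_numE// (@le_lt_trans _ _ 1%E) ?ltry// -D1.
  by apply: le_measure; rewrite ?inE//; exact: measurableI.
have v1 k : v k <= 1.
  rewrite -lee_fin -vE -D1.
  by apply: le_measure; rewrite ?inE//; exact: measurableI.
under eq_bigr do rewrite vE -EFinM.
rewrite sumEFin lee_fin -mulr_sumr ler_pM2l ?invr_gt0//.
apply: (@harmonic_distance _ _ _ i) => //.
- by rewrite addr_ge0// divr_ge0// ltW.
- exact: Sj.
- move=> k kS ki; have [m m0 dE] := natr_dist R ki.
  have d1 : 1 <= `|k%:R - i%:R| :> R by rewrite dE ler1n.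
  move: (sep i k iS kS); set d := `|_ - _| in d1 *; move=> hsep.
  have d0 : 0 < d by lra.
  have c12 : 0 <= 12 / c by rewrite divr_ge0// ltW.
  (* For adjacent indices the separation hypothesis is void, and the trivial
     bound by the length of the unit interval is used instead. *)
  have [d2|d2] := ltP d 2.
    rewrite (le_trans (v1 k))// ler_pdivlMr// mul1r.
    have : d <= 1; last by lra.
    by move: d2; rewrite /d dE ltr_nat lern1.
  have cd : c * d / 2 <= 2 ^+ j * (`|a i - a k| + `|b i - b k|).
    apply: le_trans hsep; rewrite -mulrA ler_pM2l//; lra.
  have cd0 : 0 < c * d / 2 by rewrite divr_gt0// mulr_gt0.
  rewrite -lee_fin -vE.
  have nE : `|2 ^+ j * (a i - a k)| + `|2 ^+ j * (b i - b k)| =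
      2 ^+ j * (`|a i - a k| + `|b i - b k|).
    by rewrite !normrM (gtr0_norm p0) mulrDr.
  apply: (le_trans (lebesgue_strip_le _)); rewrite nE ?lee_fin.
    exact: lt_le_trans cd.
  apply: (@le_trans _ _ (6 / (c * d / 2))).
    by rewrite ler_pM2l// lef_pV2 ?posrE// (lt_le_trans cd0).
  rewrite ler_pdivlMr// .
  have -> : 6 / (c * d / 2) * d = 12 / c by field; lra.
  lra.
Qed.

(** * Separated families of lines are null *)

Lemma nneseries_le_bound (R : realType) (a : nat -> \bar R) (K : \bar R) :
  (forall n, 0 <= a n)%E -> (forall n, \sum_(0 <= k < n) a k <= K)%E ->
  (\sum_(0 <= k <oo) a k <= K)%E.
Proof.
move=> a0 aK; apply: lime_le; first exact: is_cvg_nneseries.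
by apply: nearW => n; exact: aK.
Qed.

Lemma geometric_sum_le (R : realType) (q : R) (n : nat) : 0 <= q < 1 ->
  \sum_(0 <= k < n) q ^+ k <= (1 - q)^-1.
Proof.
move=> /andP[q0 q1]; have p : 0 < 1 - q by rewrite subr_gt0.
rewrite -(ler_pM2l p) divff ?gt_eqF// big_mkord.
have := subrX1 q n; set s := \sum_(_ < _) _ => e.
have : 0 <= q ^+ n by rewrite exprn_ge0.
have -> : (1 - q) * s = - ((q - 1) * s) by ring.
by rewrite -e; lra.
Qed.

Lemma geometric_nneseries_lty (R : realType) (C q : R) : 0 <= C -> 0 <= q < 1 ->
  (\sum_(0 <= k <oo) (C * q ^+ k)%:E < +oo)%E.
Proof.
move=> C0 q01; have /andP[q0 q1] := q01.
apply: (@le_lt_trans _ _ (C * (1 - q)^-1)%:E); last exact: ltry.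
apply: nneseries_le_bound => n.
  by rewrite lee_fin mulr_ge0// exprn_ge0.
by rewrite sumEFin lee_fin -mulr_sumr ler_wpM2l// geometric_sum_le.
Qed.

(** Bernoulli's inequality; it absorbs the factor j + 1 of [incidence_bound] into a
    geometric sequence. *)
Lemma succ_le_geometric (R : realType) (d : R) (j : nat) : 0 < d <= 1 ->
  j.+1%:R <= d^-1 * (1 + d) ^+ j.
Proof.
move=> /andP[d0 d1]; rewrite -(ler_pM2l d0) mulrA divff ?gt_eqF// mul1r.
elim: j => [|j IH]; first by rewrite expr0 mulr1.
rewrite exprS mulrDl mul1r -natr1 mulrDr mulr1 lerD//.
rewrite -[leLHS]mulr1 ler_pM2l// exprn_ege1//; lra.
Qed.

(** Otherwise the F j would have summable measures from some rank on, and by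
    Borel-Cantelli their upper limit could not contain the unit interval. *)
Lemma limsup_full_not_small (R : realType) (F : nat -> set (measurableTypeR R))
    (omega : R) : 0 <= omega < 1 -> (forall j, measurable (F j)) ->
  (forall u, 0 <= u <= 1 -> lim_sup_set F u) ->
  forall n, exists2 j, (n <= j)%N & ((omega ^+ j)%:E <= lebesgue_measure (F j))%E.
Proof.
move=> om mF full n; apply: contrapT => H.
have small j : (n <= j)%N -> (lebesgue_measure (F j) < (omega ^+ j)%:E)%E.
  by move=> nj; rewrite ltNge; apply/negP => ?; apply: H; exists j.
pose G j : set (measurableTypeR R) := if (n <= j)%N then F j else set0.
have mG j : measurable (G j) by rewrite /G; case: ifP => _ //; exact: measurable0.
have sG : (\sum_(0 <= j <oo) lebesgue_measure (G j) < +oo)%E.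
  apply: le_lt_trans (geometric_nneseries_lty ler01 om).
  apply: lee_nneseries => // j _; rewrite mul1r /G; case: ifP => [nj|_].
    exact/ltW/small.
  by rewrite measure0 lee_fin exprn_ge0//; case/andP: om.
have := lim_sup_set_cvg0 mG sG.
have mL : measurable (lim_sup_set G).
  by apply: bigcap_measurable => // k _; apply: bigcup_measurable.
have : (lebesgue_measure (`[0%R, 1%R]%classic : set R) <= lebesgue_measure (lim_sup_set G))%E.
  apply: le_measure; rewrite ?inE//.
  move=> u; rewrite /= in_itv => /full Fu m _.
  have [k /= mk Fk] := Fu (maxn m n) I.
  exists k => /=; first by rewrite (leq_trans _ mk)// leq_maxl.
  by rewrite /G (leq_trans _ mk)// leq_maxr.
rewrite lebesgue_measure_itv /= lte_fin ltr01 oppr0 adde0 => /[swap] ->.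
by rewrite lee_fin ler10.
Qed.

(** For each j, the indices of the lines that are covered at scale j in a proportion
    at least omega^j meet N dyadic intervals of length 2^-j, and
    [incidence_bound] with a suitable lam gives N 2^-j = O(q^j) with q < 1, provided
    that omega is close enough to 1.  Each index in D is of this type for
    infinitely many j, so D is null by Borel-Cantelli. *)
Theorem separated_lines_negligible_unit (R : realType) (theta K c : R)
    (Q : nat -> seq (seq int)) (D : set R) (a b : R -> R) :
  4^-1 < theta -> (forall j, uniq (Q j)) ->
  (forall j, (size (Q j))%:R * theta ^+ j <= K) -> 0 < c ->
  (forall x, D x -> 0 <= x < 1) ->
  (forall x y, D x -> D y -> c * `|x - y| <= `|a x - a y| + `|b x - b y|) ->
  (forall x, D x -> forall u, 0 <= u <= 1 -> forall j0, exists j,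
     (j0 <= j)%N /\ cell j [:: u; a x * u + b x] \in Q j) ->
  lebesgue_measure.-negligible D.
Proof.
move=> th uQ szQ c0 D01 sep cov.
have t0 : 0 < theta by lra.
(* The choice of d makes (1 + d) r < (1 - d)^2 = omega^2. *)
pose r := (4 * theta)^-1; pose d := (1 - r) / 4.
have r0 : 0 < r by rewrite invr_gt0; lra.
have r1 : r < 1 by rewrite invf_lt1; lra.
have d0 : 0 < d by rewrite /d; lra.
have d1 : d <= 1 by rewrite /d; lra.
pose omega := 1 - d.
have om0 : 0 < omega by rewrite /omega /d; lra.
have om1 : omega < 1 by rewrite /omega; lra.
pose q := (1 + d) * r / omega ^+ 2.
have q0 : 0 <= q by rewrite /q divr_ge0 ?exprn_ge0 ?mulr_ge0//; lra.
have q1 : q < 1.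
  rewrite /q ltr_pdivrMr ?exprn_gt0// mul1r.
  have -> : omega ^+ 2 = 1 - 2 * d + d ^+ 2 by rewrite /omega; ring.
  have rd : r * d < d by rewrite -[ltRHS]mul1r ltr_pM2r.
  have : 0 <= d ^+ 2 by rewrite sqr_ge0.
  have : r + 3 * d < 1 by rewrite /d; lra.
  by move: rd; lra.
have K0 : 0 <= K by apply: le_trans (szQ 0); rewrite expr0 mulr1.
pose C0 := 1 + 2 * (1 + 12 / c).
have C00 : 0 < C0.
  by have : 0 < 12 / c by [rewrite divr_gt0]; rewrite /C0; lra.
pose Dj j := [set x | D x /\
  ((omega ^+ j)%:E <= lebesgue_measure (hits j (Q j) (a x) (b x)))%E].
have Dlim x : D x -> forall n, exists2 j, (n <= j)%N & Dj j x.
  move=> Dx n.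
  have [||u u01|j nj hj] := @limsup_full_not_small R
      (fun j => hits j (Q j) (a x) (b x)) omega _ _ _ n.
  - by rewrite om1 ltW.
  - by move=> j; exact: measurable_hits.
  - move=> m _; have [j [mj hj]] := cov x Dx u u01 m.
    by exists j.
  - by exists j.
have cover j : exists B : set (measurableTypeR R),
    [/\ measurable B, Dj j `<=` B &
      (lebesgue_measure B <= (4 * C0 * K / d * q ^+ j)%:E)%E].
  have p0 : (0 : R) < 2 ^+ j by rewrite exprn_gt0.
  pose P k x := Dj j x /\ k%:R <= 2 ^+ j * x < k.+1%:R.
  pose S := [seq k <- iota 0 (2 ^ j) | `[< exists x, P k x >]].
  have [f fP] : {f : nat -> R & forall k, k \in S -> P k (f k)}.
    apply: (@choice _ _ (fun k x => k \in S -> P k x)) => k.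
    have [kS|kS] := boolP (k \in S); last by exists 0.
    by move: (kS); rewrite mem_filter => /andP[/asboolP[x Px] _]; exists x.
  pose I k : set (measurableTypeR R) := `[(k%:R / 2 ^+ j)%R, (k.+1%:R / 2 ^+ j)%R[%classic.
  have mI k : measurable (I k) by exact: measurable_itv.
  have lI k : lebesgue_measure (I k) = ((2 ^+ j)^-1)%:E.
    rewrite lebesgue_measure_itv /= lte_fin ltr_pM2r ?invr_gt0// ltr_nat ltnSn.
    by rewrite -EFinB -mulrBl -natr1 addrAC subrr add0r mul1r.
  exists (\big[setU/set0]_(k <- S) I k); split.
  - by apply: bigsetU_measurable.
  - move=> x Djx; have [Dx _] := Djx; have /andP[x0 x1] := D01 x Dx.
    pose k := `|Num.floor (2 ^+ j * x)|%N.
    have kE : (k%:R : R) = (Num.floor (2 ^+ j * x))%:~R.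
      by rewrite /k natr_absz ger0_norm// floor_ge0 mulr_ge0// ltW.
    have hk : k%:R <= 2 ^+ j * x < k.+1%:R.
      by have := floor_itv (2 ^+ j * x); rewrite intrD1 -kE natr1.
    rewrite -bigcup_seq; exists k => /=; last first.
      by rewrite /I /= in_itv /= ler_pdivrMr// ltr_pdivlMr// [x * _]mulrC.
    rewrite mem_filter mem_iota add0n /=; apply/andP; split.
      by apply/asboolP; exists x.
    have : (k%:R : R) < (2 ^ j)%:R.
      case/andP: hk => /le_lt_trans-> //; rewrite natrX.
      by rewrite -[ltRHS]mulr1 ltr_pM2l.
    by rewrite ltr_nat.
  apply: (@le_trans _ _ (\sum_(k <- S) lebesgue_measure (I k))%E).
    elim: S {fP} => [|k S IH]; first by rewrite !big_nil measure0.
    rewrite !big_cons; apply: (@le_trans _ _ (lebesgue_measure (I k) +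
        lebesgue_measure (\big[setU/set0]_(k <- S) I k))%E); last exact: leeD.
    apply: measureU2; first exact: mI.
    by apply: bigsetU_measurable.
  under eq_bigr do rewrite lI.
  rewrite sumEFin lee_fin big_const_seq count_predT iter_addr addr0.
  set N := size S.
  have oj0 : 0 < omega ^+ j by rewrite exprn_gt0.
  (* With this lam the quadratic term of incidence_bound is half of its
     left-hand side. *)
  pose lam := 2 * C0 * j.+1%:R / omega ^+ j.
  have lam0 : 0 < lam by rewrite /lam divr_gt0// !mulr_gt0.
  have H : N%:R * omega ^+ j <= lam * (size (Q j))%:R / 2 ^+ j +
      lam^-1 * N%:R * (C0 * j.+1%:R).
  apply: (@incidence_bound R j (Q j) S (a \o f) (b \o f) c) => //.
  - by rewrite filter_uniq// iota_uniq.
  - by move=> k; rewrite mem_filter mem_iota add0n => /andP[_].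
  - move=> i k /fP[[Di _] hi] /fP[[Dk _] hk] /=.
    apply: le_trans (ler_wpM2l (ltW p0) (sep _ _ Di Dk)).
    rewrite mulrCA ler_pM2l//.
    have -> : 2 ^+ j * `|f i - f k| = `|2 ^+ j * f i - 2 ^+ j * f k|.
      by rewrite -mulrBr normrM gtr0_norm.
    move: hi hk; rewrite -!natr1 => /andP[h1 h2] /andP[h3 h4].
    rewrite lerBlDr distrC; set x := _ * f i in h1 h2 *; set y := _ * f k in h3 h4 *.
    have [|] := leP (i%:R : R) k%:R => ik.
      have := ler_norm (y - x); rewrite (distrC y x).
      by rewrite (distrC i%:R) (@ger0_norm _ (k%:R - i%:R)) ?subr_ge0//; lra.
    have := ler_norm (x - y).
    by rewrite (@gtr0_norm _ (i%:R - k%:R)) ?subr_gt0//; lra.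
  - by move=> i /fP[[_ +] _].
  have e : lam^-1 * N%:R * (C0 * j.+1%:R) = N%:R * omega ^+ j / 2.
    rewrite /lam; field.
    by rewrite !gt_eqF//.
  rewrite e in H.
  have sz := szQ j.
  have tj0 : 0 < theta ^+ j by rewrite exprn_gt0.
  have {}sz : (size (Q j))%:R <= K / theta ^+ j by rewrite ler_pdivlMr.
  have H2 : N%:R * omega ^+ j / 2 <= lam * (K / theta ^+ j) / 2 ^+ j.
    apply: (@le_trans _ _ (lam * (size (Q j))%:R / 2 ^+ j)); first by lra.
    by rewrite ler_pM2r ?invr_gt0// ler_pM2l.
  have H3 : N%:R / 2 ^+ j <= 4 * C0 * K * j.+1%:R * (r / omega ^+ 2) ^+ j.
    have -> : (r / omega ^+ 2) ^+ j =
        (omega ^+ j * omega ^+ j * (2 ^+ j * 2 ^+ j) * theta ^+ j)^-1.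
      rewrite -!exprMn -[RHS]exprVn; congr (_ ^+ _).
      by rewrite /r; field; rewrite !gt_eqF.
    rewrite ler_pdivlMr; last by rewrite !mulr_gt0.
    have -> : N%:R / 2 ^+ j * (omega ^+ j * omega ^+ j * (2 ^+ j * 2 ^+ j) * theta ^+ j) =
      N%:R * omega ^+ j / 2 * (2 * (omega ^+ j * 2 ^+ j * theta ^+ j)).
      by field; rewrite gt_eqF.
    apply: le_trans (ler_wpM2r _ H2) _.
      by rewrite !mulr_ge0// ltW.
    rewrite le_eqVlt; apply/orP; left; apply/eqP.
    by rewrite /lam; field; rewrite !gt_eqF.
  rewrite -[_ *+ _]mulr_natl; apply: (le_trans H3).
  have -> : q ^+ j = (1 + d) ^+ j * (r / omega ^+ 2) ^+ j.
    by rewrite -exprMn /q mulrA.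
  rewrite mulrA; apply: ler_wpM2r.
    by rewrite exprn_ge0// divr_ge0// ltW// exprn_gt0.
  rewrite -[leRHS]mulrA; apply: ler_wpM2l.
    by rewrite !mulr_ge0// ltW.
  by rewrite succ_le_geometric// d0.
have [B BP] := choice cover.
have mB j : measurable (B j) by case: (BP j).
have sB : (\sum_(0 <= j <oo) lebesgue_measure (B j) < +oo)%E.
  have C1 : 0 <= 4 * C0 * K / d 
    by apply: divr_ge0; [rewrite !mulr_ge0// ltW|exact: ltW].
  have q01 : 0 <= q < 1 by rewrite q0.
  apply: le_lt_trans (geometric_nneseries_lty C1 q01).
  by apply: lee_nneseries => // j _; case: (BP j).
exists (lim_sup_set B); split.
- by apply: bigcap_measurable => // k _; apply: bigcup_measurable.
- exact: lim_sup_set_cvg0.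
- move=> x Dx n _; have [j nj Djx] := Dlim x Dx n.
  by exists j => //; case: (BP j) => _ + _; apply.
Qed.

(** * Images of null sets under differentiable functions *)

Lemma negligible_count_cover (R : realType) (T : countType) (D : set R)
    (F : T -> set R) : (forall i, lebesgue_measure.-negligible (F i)) ->
  (forall x, D x -> exists i, F i x) -> lebesgue_measure.-negligible D.
Proof.
move=> nF DF.
pose G n : set (measurableTypeR R) := if unpickle n is Some i then F i else set0.
apply: (@negligibleS _ _ _ _ (\bigcup_n G n)).
  move=> x /DF [i Fx]; exists (pickle i) => //.
  by rewrite /G pickleK.
apply: negligible_bigcup => n; rewrite /G; case: unpickle => [i|]; first exact: nF.
exact: negligible_set0.
Qed.

(** An interval of length l that meets D has an image of D of diameter at most
    C l. *)
Lemma negligible_lipschitz_image (R : realType) (f : R -> R) (D : set R) (C : R) :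
  0 <= C -> (forall x y, D x -> D y -> `|f x - f y| <= C * `|x - y|) ->
  lebesgue_measure.-negligible D -> lebesgue_measure.-negligible (f @` D).
Proof.
move=> C0 lip /negligible_outer_measure D0; apply/negligible_outer_measure.
apply/eqP; rewrite eq_le outer_measure_ge0 andbT; apply/lee_addgt0Pr => e e0.
rewrite add0e.
have e1 : 0 < e / (2 * C + 1) by rewrite divr_gt0//; lra.
have [F [Fitv DF] Fe] : exists2 F : nat -> set R, open_itv_cover D F &
    (\sum_(0 <= k <oo) wlength idfun (F k) < (e / (2 * C + 1))%:E)%E.
  have : (ereal_inf [set \sum_(k <oo) wlength (@idfun R) (F k) | F in open_itv_cover D]
      < (e / (2 * C + 1))%:E)%E.
    by rewrite -outer_measure_open_itv_cover D0 lte_fin.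
  by move=> /ereal_inf_lt [_ /= [F cF <-] lt]; exists F.
have w0 k : (0 <= wlength idfun (F k))%E.
  by have [[a b] ->] := Fitv k; exact: wlength_itv_ge0.
apply: (@le_trans _ _ ((wlength idfun)^*%mu (\bigcup_k (f @` (D `&` F k))))).
  apply: le_outer_measure => _ [x Dx <-].
  by have [k _ Fx] := DF x Dx; exists k => //; exists x.
apply: le_trans (outer_measure_sigma_subadditive _ _) _.
apply: (@le_trans _ _ (\sum_(0 <= k <oo) (2 * C)%:E * wlength idfun (F k))%E); last first.
  rewrite nneseriesZl//.
  have C20 : 0 <= 2 * C by rewrite mulr_ge0.
  apply: (@le_trans _ _ ((2 * C)%:E * (e / (2 * C + 1))%:E)%E).
    by apply: lee_wpmul2l; [rewrite lee_fin|exact: ltW].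
  rewrite -EFinM lee_fin mulrA ler_pdivrMr; last by lra.
  by rewrite mulrC ler_pM2l//; lra.
apply: lee_nneseries => k _; first by move=> _; exact: outer_measure_ge0.
have [[a b] /= FE] := Fitv k.
have [->|/set0P[x0 [Dx0 Fx0]]] := eqVneq (D `&` F k) set0.
  by rewrite image_set0 outer_measure0 mule_ge0// lee_fin mulr_ge0.
have ab : a < b.
  by move: Fx0; rewrite FE /= in_itv /= => /andP[+ +]; exact: lt_trans.
have -> : (wlength idfun (F k) = (b - a)%:E)%E.
  by rewrite FE wlength_itv /= lte_fin ab.
set r := C * (b - a).
have r0 : 0 <= r by rewrite mulr_ge0// subr_ge0 ltW.
apply: (@le_trans _ _
    (lebesgue_measure (`[(f x0 - r)%R, (f x0 + r)%R]%classic : set R))).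
  apply: le_outer_measure => _ [x [Dx Fx] <-] /=.
  rewrite in_itv /= -ler_distl; apply: le_trans (lip _ _ Dx Dx0) _.
  rewrite ler_wpM2l// ler_norml.
  move: Fx Fx0; rewrite FE /= !in_itv /= => /andP[? ?] /andP[? ?].
  by apply/andP; lra.
rewrite lebesgue_measure_itv /=; case: ifP => _; last first.
  by rewrite -EFinM lee_fin !mulr_ge0// subr_ge0 ltW.
by rewrite -EFinM -EFinB lee_fin /r; lra.
Qed.

Lemma derivable_approx (R : realType) (f : R -> R) (x df e : R) :
  is_derive x (1 : R) f df -> 0 < e ->
  exists2 d, 0 < d &
    forall y, `|y - x| < d -> `|f y - f x - df * (y - x)| <= e * `|y - x|.
Proof.
move=> [fx dfE] e0.
have /cvgrPdist_le /(_ e e0) : (fun h : R => h^-1 *: ((f \o shift x) (h *: (1:R)) - f x))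
   @ 0^' --> df by rewrite -dfE; exact: fx.
rewrite near_withinE => /nbhs_ballP [d /= d0 H].
exists d => // y yd.
have [->|yx] := eqVneq y x; first by rewrite !subrr mulr0 subrr normr0 mulr0.
have h0 : y - x != 0 by rewrite subr_eq0.
have := H (y - x); rewrite /ball /= sub0r normrN => /(_ yd h0).
rewrite /GRing.scale /= mulr1 subrK => He.
have -> : f y - f x - df * (y - x) = - ((y - x) * (df - (y - x)^-1 * (f y - f x))).
  by field.
by rewrite normrN normrM mulrC ler_wpM2r.
Qed.

(** A function that is differentiable on D is Lipschitz on each of countably many
    pieces that cover D: the points where the growth is bounded by m up to distance
    1 / (m + 1), cut into pieces of diameter less than 1 / (m + 1). *)
Lemma negligible_derivable_image (R : realType) (f : R -> R) (D : set R) :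
  (forall x, D x -> derivable f x 1) ->
  lebesgue_measure.-negligible D -> lebesgue_measure.-negligible (f @` D).
Proof.
move=> df D0.
pose P (ml : nat * int) x := [/\ D x, Num.floor (ml.1.+1%:R * x) = ml.2 &
  forall y, `|y - x| < ml.1.+1%:R^-1 -> `|f y - f x| <= ml.1%:R * `|y - x|].
apply: (@negligible_count_cover R _ _ (fun ml => f @` [set x | P ml x])).
  move=> ml; apply: (@negligible_lipschitz_image _ _ _ ml.1%:R) => //.
    move=> x y [_ fx _] [_ fy Hy]; apply: Hy.
    have m0 : (0 : R) < ml.1.+1%:R by [].
    rewrite -(ltr_pM2l m0) divff ?gt_eqF// -{1}(gtr0_norm m0) -normrM mulrBr.
    have := floor_itv (ml.1.+1%:R * x); have := floor_itv (ml.1.+1%:R * y).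
    rewrite fx fy intrD1 => /andP[? ?] /andP[? ?].
    by rewrite ltr_norml; apply/andP; lra.
  by apply: negligibleS D0 => x [].
move=> _ [x Dx <-].
have [d d0 H] := derivable_approx (derivableP (df x Dx)) ltr01.
set c := 'D_1 f x in H.
pose m := (Num.trunc (`|c| + 1 + d^-1)).+1.
have mb : `|c| + 1 + d^-1 < m%:R by rewrite /m truncnS_gt.
have di0 : 0 < d^-1 by rewrite invr_gt0.
have c0 := normr_ge0 c.
exists (m, Num.floor (m.+1%:R * x)), x => //; split => //= y yx.
have /H : `|y - x| < d.
  apply: (lt_le_trans yx); rewrite -[leRHS]invrK lef_pV2 ?posrE//.
  by rewrite -natr1; lra.
move=> {}H.
have -> : f y - f x = (f y - f x - c * (y - x)) + c * (y - x) by ring.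
rewrite (le_trans (ler_normD _ _))// normrM.
apply: (le_trans (lerD H (lexx _))).
by rewrite -mulrDl ler_wpM2r//; lra.
Qed.

(** * Slices of families of cells *)

(** With theta = 2^-s this is, up to a constant, the sum of the s-th powers of the
    diameters of the cells in the lists L k, of scale sc k.  Working with theta
    turns every change of exponent into a multiplication by a power of 2. *)
Definition budget (R : realType) (theta : R) (sc : nat -> nat)
    (L : nat -> seq (seq int)) : \bar R :=
  (\sum_(0 <= k <oo) ((size (L k))%:R * theta ^+ sc k)%:E)%E.

Definition frequently_in (R : realType) (sc : nat -> nat)
    (L : nat -> seq (seq int)) (p : seq R) : Prop :=
  forall j0, exists k, (j0 <= sc k)%N /\ cell (sc k) p \in L k.

Definition slice (h : int) (l : seq (seq int)) : seq (seq int) :=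
  [seq behead c | c <- l & ohead c == Some h].

Definition slice_at (R : realType) (sc : nat -> nat)
    (L : nat -> seq (seq int)) (t : R) : nat -> seq (seq int) :=
  fun k => slice (Num.floor (2 ^+ sc k * t)) (L k).

Lemma mem_slice (h : int) (c : seq int) (l : seq (seq int)) :
  h :: c \in l -> c \in slice h l.
Proof.
by move=> hl; apply/mapP; exists (h :: c); rewrite ?mem_filter//= eqxx.
Qed.

Lemma frequently_slice (R : realType) sc L (t : R) (p : seq R) :
  frequently_in sc L (t :: p) -> frequently_in sc (slice_at sc L t) p.
Proof.
by move=> F j0; have [k [jk ck]] := F j0; exists k; split => //; exact: mem_slice.
Qed.

(** Fubini: a cell of scale j contributes to the slice at t only for t in an interval
    of length 2^-j, so the integral over t of the budgets of the slices with
    parameter 2 theta is at most the budget with parameter theta. *)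
Lemma slice_budget (R : realType) (theta a b : R) sc L : 0 <= theta -> a < b ->
  (budget theta sc L < +oo)%E ->
  exists2 t, a < t < b & (budget (2 * theta) sc (slice_at sc L t) < +oo)%E.
Proof.
move=> t0 ab bL; apply: contrapT => H.
pose D : set (measurableTypeR R) := `]a, b[%classic.
have mD : measurable D by exact: measurable_itv.
have DE t : D t -> a < t < b by rewrite /D /= in_itv.
pose F k (t : R) := \sum_(c <- L k) (2 * theta) ^+ sc k * \1_(@slab R (sc k) c) t.
have FE k t : F k t = (size (slice_at sc L t k))%:R * (2 * theta) ^+ sc k.
  rewrite /F /slice_at /slice size_map size_filter -sum1_count natr_sum mulr_suml.
  rewrite [RHS]big_mkcond /=; apply: eq_bigr => c _; rewrite indicE.
  have -> : (t \in @slab R (sc k) c) = (ohead c == Some (Num.floor (2 ^+ sc k * t))).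
    by apply/idP/idP; rewrite inE.
  by case: eqP => _; rewrite ?mulr0 ?mulr1 ?mul1r.
have w0 k : 0 <= (2 * theta) ^+ sc k by rewrite exprn_ge0// mulr_ge0.
have inf t : D t -> (\sum_(0 <= k <oo) (F k t)%:E = +oo)%E.
  move=> /DE abt; apply/eqP; rewrite -leye_eq leNgt; apply/negP => lt.
  apply: H; exists t => //; rewrite /budget.
  by under eq_eseriesr do rewrite -FE.
have F0 k t : 0 <= F k t by rewrite FE mulr_ge0.
have mF k : measurable_fun D (fun t : measurableTypeR R => (F k t)%:E).
  apply/measurable_EFinP; apply: measurable_sum => c.
  apply: measurable_funM => //; apply: measurable_indic; exact: measurable_slab.
have : (\int[lebesgue_measure]_(t in D) (\sum_(0 <= k <oo) (F k t)%:E) < +oo)%E.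
  rewrite integral_nneseries//; last by move=> k t _; rewrite lee_fin.
  apply: le_lt_trans bL; apply: lee_nneseries => k _.
    by move=> _; apply: integral_ge0 => t _; rewrite lee_fin.
  rewrite integral_sum_indic//; last by move=> c; exact: measurable_slab.
  have -> : (size (L k))%:R * theta ^+ sc k = \sum_(c <- L k) theta ^+ sc k.
    by rewrite big_const_seq count_predT iter_addr addr0 mulr_natl.
  rewrite -sumEFin; apply: lee_sum => c _.
  have -> : theta ^+ sc k = (2 * theta) ^+ sc k * (2 ^+ sc k)^-1.
    by rewrite exprMn mulrAC divff ?mul1r// expf_neq0.
  by rewrite EFinM lee_wpmul2l ?lee_fin//; exact: lebesgue_slab_le.
rewrite (eq_integral (cst +oo%E)); last by move=> t /[!inE] /inf.
have lD : lebesgue_measure D = (b - a)%:E.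
  by rewrite lebesgue_measure_itv /= lte_fin ab.
rewrite integral_cst// [X in (_ * X)%E](_ : _ = (b - a)%:E)// mulyr.
by rewrite gtr0_sg ?subr_gt0// mul1e ltxx.
Qed.

(** Slice successively along the coordinates in c, each time at a value closer than r
    to the prescribed one. *)
Lemma slices_budget (R : realType) (theta r : R) sc L (c : seq R) :
  0 <= theta -> 0 < r -> (budget theta sc L < +oo)%E ->
  exists (ys : seq R) (L' : nat -> seq (seq int)),
    [/\ size ys = size c,
        (forall k, `|nth 0 ys k - nth 0 c k| < r),
        (budget (2 ^+ size c * theta) sc L' < +oo)%E &
        forall p, frequently_in sc L (ys ++ p) -> frequently_in sc L' p].
Proof.
elim: c theta L => [|x c IH] theta L t0 r0 bL.
  exists [::], L; split => //; last by rewrite mul1r.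
  by move=> k; rewrite subrr normr0.
have [t xt bt] : exists2 t, x - r < t < x + r &
    (budget (2 * theta) sc (slice_at sc L t) < +oo)%E.
  by apply: slice_budget => //; lra.
have [|ys [L' [sz nr b' fr]]] := IH (2 * theta) _ _ r0 bt; first by rewrite mulr_ge0.
exists (t :: ys), L'; split.
- by rewrite /= sz.
- by case=> [|k] /=; rewrite ?nr// ltr_norml; apply/andP; lra.
- by rewrite /= exprSr -mulrA.
- by move=> p /frequently_slice /fr.
Qed.

(** * Curves in the plane *)

(** A finite budget leaves finitely many nonempty lists at each scale.  Collecting
    them gives, for each j, a duplicate-free list of cells with at most K theta^-j
    elements. *)
Lemma per_scale_cells (R : realType) (theta : R) sc L : 0 < theta ->
  (budget theta sc L < +oo)%E ->
  exists (K : R) (Q : nat -> seq (seq int)),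
    [/\ (forall j, uniq (Q j)),
        (forall j, (size (Q j))%:R * theta ^+ j <= K) &
        forall p : seq R, frequently_in sc L p ->
          forall j0, exists j, (j0 <= j)%N /\ cell j p \in Q j].
Proof.
move=> t0 bL.
pose a k := (size (L k))%:R * theta ^+ sc k.
have a0 k : 0 <= a k by rewrite mulr_ge0// exprn_ge0// ltW.
have ae0 k : (0 <= (a k)%:E)%E by rewrite lee_fin.
have sum_le n : \sum_(0 <= k < n) a k <= fine (budget theta sc L).
  rewrite -lee_fin fineK; last first.
    by rewrite ge0_fin_numE//; apply: nneseries_ge0 => k _ _; exact: ae0.
  rewrite -sumEFin; apply: (@nneseries_lim_ge _ (fun k => (a k)%:E) xpredT) => k _ _.
  exact: ae0.
(* Each nonempty list of scale j contributes at least theta^j to the budget. *)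
have late j : {n | forall k, sc k = j -> L k != [::] -> (k < n)%N}.
  apply: cid.
  have tj0 : 0 < theta ^+ j by rewrite exprn_gt0.
  pose m := (Num.trunc (fine (budget theta sc L) / theta ^+ j)).+1.
  apply: contrapT => H.
  have many i : exists n, i%:R * theta ^+ j <= \sum_(0 <= k < n) a k.
    elim: i => [|i [n IH]]; first by exists 0%N; rewrite big_geq// mul0r.
    have [k [skj Lk nk]] : exists k, [/\ sc k = j, L k != [::] & (n <= k)%N].
      apply: contrapT => G; apply: H; exists n => k skj Lk.
      by rewrite ltnNge; apply/negP => nk; apply: G; exists k.
    exists k.+1; rewrite big_nat_recr//= -natr1 mulrDl mul1r lerD//.
      apply: (le_trans IH); rewrite (big_cat_nat (leq0n n) nk) /=.
      by rewrite lerDl sumr_ge0.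
    rewrite /a skj -[leLHS]mul1r ler_pM2r// ler1n.
    by case: (L k) Lk.
  have [n] := many m; apply/negP; rewrite -ltNge.
  apply: (le_lt_trans (sum_le n)).
  by rewrite -ltr_pdivrMr// truncnS_gt.
pose n0 j := sval (late j).
pose Q j := undup (flatten [seq L k | k <- iota 0 (n0 j) & sc k == j]).
exists (fine (budget theta sc L)), Q; split.
- by move=> j; exact: undup_uniq.
- move=> j; apply: le_trans (sum_le (n0 j)).
  apply: (@le_trans _ _ (\sum_(0 <= k < n0 j | sc k == j) a k)); last first.
    rewrite [leRHS](bigID (fun k => sc k == j)) /= lerDl sumr_ge0//.
  apply: (@le_trans _ _ (\sum_(0 <= k < n0 j | sc k == j) (size (L k))%:R * theta ^+ j)).
    rewrite -mulr_suml ler_pM2r ?exprn_gt0// -natr_sum ler_nat.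
    apply: leq_trans (size_undup _) _.
    rewrite size_flatten sumnE /shape -map_comp big_map big_filter.
    by rewrite /index_iota subn0.
  by apply: ler_sum => k /eqP <-.
- move=> p fp j0; have [k [jk ck]] := fp j0.
  exists (sc k); split => //; rewrite mem_undup; apply/flattenP.
  exists (L k) => //; apply: map_f; rewrite mem_filter eqxx mem_iota /= add0n.
  apply: (svalP (late (sc k))) => //.
  by case: (L k) ck.
Qed.

Definition covering_cells (R : realType) (theta K : R)
    (Q : nat -> seq (seq int)) : Prop :=
  (forall j, uniq (Q j)) /\ (forall j, (size (Q j))%:R * theta ^+ j <= K).

(** The general case of [separated_lines_negligible_unit], obtained by cutting D at
    the integers and translating. *)
Lemma separated_lines_negligible (R : realType) (theta K c : R)
    (Q : nat -> seq (seq int)) (D : set R) (a b : R -> R) :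
  4^-1 < theta -> covering_cells theta K Q -> 0 < c ->
  (forall x y, D x -> D y -> c * `|x - y| <= `|a x - a y| + `|b x - b y|) ->
  (forall x, D x -> forall u, forall j0, exists j,
     (j0 <= j)%N /\ cell j [:: u; a x * u + b x] \in Q j) ->
  lebesgue_measure.-negligible D.
Proof.
move=> th [uQ szQ] c0 sep cov.
pose E (l : int) := [set x | (0 <= x < 1) /\ D (x + l%:~R)].
apply: (@negligible_count_cover R _ _ (fun l => (fun x => x + l%:~R) @` E l)).
  move=> l; apply: (@negligible_lipschitz_image _ _ _ 1) => //.
    by move=> x y _ _; rewrite mul1r opprD addrACA subrr addr0.
  apply: (@separated_lines_negligible_unit R theta K c Q _ (fun x => a (x + l%:~R))
    (fun x => b (x + l%:~R))) => //.
  - by move=> x [].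
  - move=> x y [_ Dx] [_ Dy]; have := sep _ _ Dx Dy.
    by rewrite opprD addrACA subrr addr0.
  - by move=> x [_ Dx] u _; exact: cov.
move=> x Dx; exists (Num.floor x), (x - (Num.floor x)%:~R); last by rewrite subrK.
split; last by rewrite subrK.
by have := floor_itv x; rewrite intrD1 => /andP[? ?]; apply/andP; lra.
Qed.

(** Exchanging the two coordinates turns vertical lines into the horizontal lines
    z = x, whose parameters are separated. *)
Lemma vertical_lines_negligible (R : realType) (theta K : R)
    (Q : nat -> seq (seq int)) (D : set R) :
  4^-1 < theta -> covering_cells theta K Q ->
  (forall x, D x -> forall z, forall j0, exists j,
     (j0 <= j)%N /\ cell j [:: x; z] \in Q j) ->
  lebesgue_measure.-negligible D.
Proof.
move=> th [uQ szQ] cov.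
apply: (@separated_lines_negligible R theta K 1 (fun j => map rev (Q j)) D
  (fun=> 0) id) => //.
- split=> j; first by rewrite map_inj_uniq//; exact: can_inj revK.
  by rewrite size_map.
- by move=> x y _ _; rewrite subrr normr0 add0r mul1r.
- move=> x Dx z j0; have [j [jj cj]] := cov x Dx z j0.
  exists j; split => //; rewrite mul0r add0r.
  by apply/mapP; exists (cell j [:: x; z]).
Qed.

(** Where the slope a x differs from f1 x by at least 2 e and the first order
    expansion of f at x has an error of at most e |y - x|, the line through
    (x, f x) passes above or below (y, f y) at a distance of at least e |y - x|;
    so the parameters are separated on the piece formed by such x, cut into
    short intervals.  Countably many pieces of this kind cover D. *)
Lemma transversal_lines_negligible (R : realType) (theta K B : R)
    (Q : nat -> seq (seq int)) (D : set R) (f f1 a b : R -> R) :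
  4^-1 < theta -> covering_cells theta K Q ->
  (forall x, D x -> `|x| <= B) ->
  (forall x, D x -> is_derive x (1:R) f (f1 x)) ->
  (forall x, D x -> f x = a x * x + b x /\ a x != f1 x) ->
  (forall x, D x -> forall u, forall j0, exists j,
     (j0 <= j)%N /\ cell j [:: u; a x * u + b x] \in Q j) ->
  lebesgue_measure.-negligible D.
Proof.
move=> th cQ DB df fab cov.
pose P (p : nat * nat * int) := [set x | [/\ D x,
  Num.floor (p.1.2.+1%:R * x) = p.2, 2 * p.1.1.+1%:R^-1 <= `|a x - f1 x| &
  forall y, `|y - x| < p.1.2.+1%:R^-1 ->
    `|f y - f x - f1 x * (y - x)| <= p.1.1.+1%:R^-1 * `|y - x|]].
apply: (@negligible_count_cover R _ _ P).
  move=> [[m1 m] l]; set e : R := m1.+1%:R^-1.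
  have m0 : (0 : R) < m.+1%:R by [].
  have e0 : 0 < e by rewrite invr_gt0.
  have B1 : 0 < 1 + `|B| by rewrite ltr_pwDl.
  apply: (@separated_lines_negligible R theta K (e / (1 + `|B|)) Q _ a b) => //.
  - by rewrite divr_gt0.
  - move=> x y [Dx flx ax Hx] [Dy fly _ _]; rewrite /= in flx fly.
    have xy : `|y - x| < m.+1%:R^-1.
      rewrite -(ltr_pM2l m0) divff ?gt_eqF// -{1}(gtr0_norm m0) -normrM mulrBr.
      have := floor_itv (m.+1%:R * x); have := floor_itv (m.+1%:R * y).
      rewrite flx fly intrD1 => /andP[? ?] /andP[? ?].
      by rewrite ltr_norml; apply/andP; lra.
    have {}Hx := Hx y xy; rewrite /= -/e in Hx ax.
    have [fx _] := fab x Dx; have [fy _] := fab y Dy.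
    have E : (a y - a x) * y + (b y - b x) =
       (f y - f x - f1 x * (y - x)) - (a x - f1 x) * (y - x).
      by rewrite fx fy; ring.
    have lo : e * `|y - x| <= `|(a y - a x) * y + (b y - b x)|.
      have := lerB_dist ((a x - f1 x) * (y - x)) (f y - f x - f1 x * (y - x)).
      rewrite (distrC (_ * _)) -E normrM.
      have : 2 * e * `|y - x| <= `|a x - f1 x| * `|y - x| by rewrite ler_wpM2r.
      by move: Hx; lra.
    have yB : `|y| <= `|B|.
      by apply: (le_trans (DB _ Dy)); exact: ler_norm.
    have hi : `|(a y - a x) * y + (b y - b x)| <=
        (1 + `|B|) * (`|a x - a y| + `|b x - b y|).
      apply: (le_trans (ler_normD _ _)); rewrite normrM (distrC (a y)) (distrC (b y)).
      rewrite mulrDr lerD//.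
        by rewrite mulrC ler_wpM2r//; lra.
      by rewrite -[leLHS]mul1r ler_wpM2r// lerDl.
    rewrite mulrAC ler_pdivrMr// distrC [leRHS]mulrC.
    exact: le_trans lo hi.
  - by move=> x [Dx _ _ _]; exact: cov.
move=> x Dx; have [_ ax] := fab x Dx.
have g0 : 0 < `|a x - f1 x| by rewrite normr_gt0 subr_eq0.
set g := `|a x - f1 x| in g0.
have g2 : 0 < g / 2 by rewrite divr_gt0.
pose m1 := Num.trunc (g / 2)^-1.
have m1P : m1.+1%:R^-1 <= g / 2.
  by rewrite -[leRHS]invrK lef_pV2 ?posrE ?invr_gt0// ltW// truncnS_gt.
have m10 : (0 : R) < m1.+1%:R^-1 by rewrite invr_gt0.
have [d d0 H] := derivable_approx (df x Dx) m10.
pose m2 := Num.trunc d^-1.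
have m2P : m2.+1%:R^-1 <= d.
  by rewrite -[leRHS]invrK lef_pV2 ?posrE ?invr_gt0// ltW// truncnS_gt.
exists (m1, m2, Num.floor (m2.+1%:R * x)); split => //.
  by rewrite -[leRHS](@divfK _ 2)// mulrC ler_pM2r.
by move=> y yx; apply: H; exact: lt_le_trans m2P.
Qed.

(** Split the points of the curve according to whether the line through them is
    vertical (V), transversal (T) or tangent (G).  V and T are null, and so is their
    image under the derivable function f1; the set of slopes f1 @` G is null as
    well.  So f1 has a null image on the interval, and the intermediate value
    theorem forces it to be constant. *)
Theorem curve_not_coverable (R : realType) (theta al be : R) sc L (f f1 : R -> R) :
  4^-1 < theta -> (budget theta sc L < +oo)%E ->
  (forall u, al < u < be -> is_derive u (1:R) f (f1 u)) ->
  (forall u, al < u < be -> derivable f1 u 1) ->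
  (forall u, al < u < be -> exists d1 d2, (d1 != 0) || (d2 != 0) /\
     forall t, frequently_in sc L [:: u + t * d1; f u + t * d2]) ->
  forall u v, al < u < be -> al < v < be -> f1 u = f1 v.
Proof.
move=> th bL df df1 cov.
have t0 : 0 < theta by lra.
have [K [Q [uQ szQ frQ]]] := per_scale_cells t0 bL.
have cQ : covering_cells theta K Q by [].
pose I := [set u : R | al < u < be].
pose V := [set u | I u /\ forall z : R, frequently_in sc L [:: u; z]].
pose line (a b : R) := forall x : R, frequently_in sc L [:: x; a * x + b].
pose tr (u : R) (ab : R * R) := [/\ f u = ab.1 * u + ab.2, ab.1 != f1 u & line ab.1 ab.2].
pose T := [set u | I u /\ exists ab, tr u ab].
pose G := [set u | I u /\ line (f1 u) (f u - f1 u * u)].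
have split u : I u -> [\/ V u, T u | G u].
  move=> Iu; have [d1 [d2 [dn0 H]]] := cov u Iu.
  have [d10|d10] := eqVneq d1 0.
    apply: Or31; split => // z.
    have d20 : d2 != 0 by move: dn0; rewrite d10 eqxx.
    have := H ((z - f u) / d2); rewrite d10 mulr0 addr0 divfK// addrC subrK.
    exact.
  have lin : line (d2 / d1) (f u - d2 / d1 * u).
    move=> x; have := H ((x - u) / d1); rewrite divfK// addrC subrK.
    have -> // : f u + (x - u) / d1 * d2 = d2 / d1 * x + (f u - d2 / d1 * u).
    by field.
  have [e|ne] := eqVneq (d2 / d1) (f1 u).
    by apply: Or33; split => //; rewrite -e.
  apply: Or32; split => //; exists (d2 / d1, f u - d2 / d1 * u); split => //=.
  by rewrite addrC subrK.
have V0 : lebesgue_measure.-negligible V.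
  apply: (@vertical_lines_negligible R theta K Q) => // x [_ H] z j0.
  exact: frQ.
have T0 : lebesgue_measure.-negligible T.
  have [ab abP] : {ab : R -> R * R & forall u, T u -> tr u (ab u)}.
    apply: (@choice _ _ (fun u p => T u -> tr u p)) => u.
    have [[Iu [p Hp]]|nT] := pselect (T u); first by exists p.
    by exists (0, 0).
  apply: (@transversal_lines_negligible R theta K (`|al| + `|be|) Q T f f1
    (fun u => (ab u).1) (fun u => (ab u).2)) => //.
  - move=> x [/andP[xa xb] _]; rewrite ler_norml.
    have := ler_norm be; have := ler_norm (- al); rewrite normrN.
    have := normr_ge0 al; have := normr_ge0 be.
    by move=> *; apply/andP; lra.
  - by move=> x [Ix _]; exact: df.
  - by move=> x /abP [? ? _].
  - by move=> x /abP [_ _ H] u j0; exact: frQ.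
have G0 : lebesgue_measure.-negligible (f1 @` G).
  have [g gP] : {g : R -> R & forall p, (f1 @` G) p -> G (g p) /\ f1 (g p) = p}.
    apply: (@choice _ _ (fun p u => (f1 @` G) p -> G u /\ f1 u = p)) => p.
    have [[u Gu <-]|nT] := pselect ((f1 @` G) p); first by exists u.
    by exists 0.
  apply: (@separated_lines_negligible R theta K 1 Q _ id
    (fun p => f (g p) - p * g p)) => //.
  - by move=> x y _ _; rewrite mul1r lerDl.
  - move=> p /gP [[_ H] e] u j0; apply: frQ; have := H u; rewrite e.
    exact.
have I0 : lebesgue_measure.-negligible (f1 @` I).
  have VT0 : lebesgue_measure.-negligible (f1 @` (V `|` T)).
    apply: negligible_derivable_image; last exact: negligibleU.
    by move=> x [[Ix _]|[Ix _]]; exact: df1.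
  apply: negligibleS (negligibleU VT0 G0) => _ [u Iu <-].
  have [Vu|Tu|Gu] := split u Iu.
  - by left; exists u => //; left.
  - by left; exists u => //; right.
  - by right; exists u.
move=> u v Iu Iv; apply/eqP/negPn/negP => uv.
wlog lt : u v Iu Iv uv / u <= v.
  move=> W; have [uv'|/ltW vu] := leP u v; first exact: (W u v).
  by apply: (W v u) => //; rewrite eq_sym.
pose mn := Num.min (f1 u) (f1 v); pose mx := Num.max (f1 u) (f1 v).
have mm : mn < mx.
  by rewrite /mn /mx; case: (ltgtP (f1 u) (f1 v)) uv.
have sub : `[mn, mx]%classic `<=` f1 @` I.
  move=> y; rewrite /= in_itv /= => my.
  have cf1 : {within `[u, v], continuous f1}.
    move: Iu Iv => /andP[? ?] /andP[? ?].
    apply: derivable_within_continuous => x; rewrite in_itv /= => /andP[? ?].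
    by apply: df1; apply/andP; lra.
  have [w wI wy] := IVT lt cf1 my.
  exists w => //; move: Iu Iv wI; rewrite in_itv /=.
  by move=> /andP[? ?] /andP[? ?] /andP[? ?]; apply/andP; lra.
pose J : set (measurableTypeR R) := `[mn, mx]%classic.
have NJ : lebesgue_measure.-negligible J by apply: negligibleS I0.
have mJ : measurable J by exact: measurable_itv.
have lJ : lebesgue_measure J = (mx - mn)%:E.
  by rewrite lebesgue_measure_itv /= lte_fin mm.
have : ((mx - mn)%:E = 0)%E by rewrite -lJ; exact/negligibleP.
by move=> [] /eqP; rewrite subr_eq0 gt_eqF.
Qed.

(** * Hausdorff null sets *)

(** A double series with nonnegative terms as a simple series. *)
Lemma nat_pairing : exists e : nat -> nat * nat,
  (forall p, exists k, e k = p) /\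
  forall (R : realType) (a : nat -> nat -> \bar R), (forall i j, 0 <= a i j)%E ->
    (\sum_(0 <= k <oo) a (e k).1 (e k).2 =
     \sum_(0 <= i <oo) \sum_(0 <= j <oo) a i j)%E.
Proof.
have /card_esym/ppcard_eqP[f] := card_nat2.
exists f; split.
  by move=> p; exists (f^-1%FUN p); rewrite invK ?inE.
move=> R a a0.
rewrite nneseries_esumT//.
have bf : set_bij [set: nat] [set: nat * nat] f by exact: bij.
rewrite -(@reindex_esum R nat (nat * nat)%type _ _ f
  (fun p => a p.1 p.2) bf).
rewrite nneseries_esumT; last by move=> i; exact: nneseries_ge0.
have -> : [set: nat * nat] = [set: nat] `*`` (fun=> [set: nat]).
  by apply/seteqP; split.
rewrite -esum_esum//; apply: eq_esum => i _.
by rewrite nneseries_esumT.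
Qed.

Lemma expr_lt_eventually (R : realType) (q e : R) : 0 <= q < 1 -> 0 < e ->
  exists j0, forall j, (j0 <= j)%N -> q ^+ j < e.
Proof.
move=> /andP[q0 q1] e0.
have : (fun j => q ^+ j) @ \oo --> (0 : R) by apply: cvg_expr; rewrite ger0_norm.
move=> /cvgrPdist_lt /(_ e e0) [j0 _ H]; exists j0 => j jj.
by have := H j jj; rewrite sub0r normrN ger0_norm// exprn_ge0.
Qed.

Lemma nneseries_half_powers_le (R : realType) (C : R) : 0 <= C ->
  (\sum_(0 <= k <oo) (C * 2^-1 ^+ k)%:E <= (2 * C)%:E)%E.
Proof.
move=> C0; apply: nneseries_le_bound => n.
  by rewrite lee_fin mulr_ge0// exprn_ge0.
rewrite sumEFin lee_fin -mulr_sumr mulrC ler_wpM2r//.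
apply: le_trans (geometric_sum_le _ _) _; first by lra.
by rewrite -[leRHS]invrK lef_pV2 ?posrE; lra.
Qed.

Section Hausdorff.
Variables (R : realType) (N : nat).
Implicit Types (E U : set 'rV[R]_N) (s d : R).

Lemma enorm_ge0 (x : 'rV[R]_N) : 0 <= enorm x.
Proof. exact: sqrtr_ge0. Qed.

Lemma coord_le_enorm (x : 'rV[R]_N) i : `|x ord0 i| <= enorm x.
Proof.
rewrite -sqrtr_sqr ler_wsqrtr// (bigD1 i)//= lerDl sumr_ge0// => k _.
exact: sqr_ge0.
Qed.

Lemma enorm_le_sum (x : 'rV[R]_N) : enorm x <= \sum_i `|x ord0 i|.
Proof.
have S0 : 0 <= \sum_i `|x ord0 i| by apply: sumr_ge0.
rewrite -(ger0_norm S0) -sqrtr_sqr ler_wsqrtr//.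
rewrite expr2 mulr_suml; apply: ler_sum => i _.
rewrite -[x ord0 i ^+ 2]ger0_norm ?sqr_ge0// normrX expr2 ler_wpM2l//.
by rewrite (bigD1 i)//= lerDl sumr_ge0.
Qed.

Lemma ediam_ge0 U : (0 <= ediam U)%E.
Proof. by apply: ereal_sup_ubound; left. Qed.

Lemma enorm_le_ediam U p q : U p -> U q -> ((enorm (p - q))%:E <= ediam U)%E.
Proof. by move=> Up Uq; apply: ereal_sup_ubound; right; exists (p, q). Qed.

Lemma ediam_le U d : 0 <= d -> (forall p q, U p -> U q -> enorm (p - q) <= d) ->
  (ediam U <= d%:E)%E.
Proof.
move=> d0 H; apply: ge_ereal_sup => _ [->|[[p q] /= [Up Uq] <-]]; rewrite lee_fin//.
exact: H.
Qed.

Lemma hausdorff_weight_ge0 s U : (0 <= hausdorff_weight s U)%E.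
Proof. by rewrite /hausdorff_weight; case: ifP => // _; exact: poweR_ge0. Qed.

(** The covers that witness that the Hausdorff premeasure of E is at most eps. *)
Definition small_cover s d eps E : Prop := exists V : nat -> set 'rV[R]_N,
  [/\ (forall k, (ediam (V k) <= d%:E)%E), E `<=` \bigcup_k V k &
      (\sum_(0 <= k <oo) hausdorff_weight s (V k) <= eps%:E)%E].

Lemma hausdorff_premeasure_ge0 s d E : (0 <= hausdorff_premeasure s d E)%E.
Proof.
apply: le_ereal_inf_tmp => _ [V _ <-]; apply: nneseries_ge0 => k _ _.
exact: hausdorff_weight_ge0.
Qed.

Lemma hausdorff_null_small_cover s E : hausdorff_measure s E = 0%E <->
  forall d, 0 < d -> forall eps, 0 < eps -> small_cover s d eps E.
Proof.
split=> [H0 d d0 eps eps0|H].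
  have : (hausdorff_premeasure s d E < eps%:E)%E.
    apply: (@le_lt_trans _ _ 0%E); rewrite ?lte_fin// -H0.
    by apply: ereal_sup_ubound; exists d.
  move=> /ereal_inf_lt [_ /= [V [dV EV] <-] /ltW lt].
  by exists V.
apply/eqP; rewrite eq_le; apply/andP; split; last first.
  apply: (le_trans (hausdorff_premeasure_ge0 s 1 E)).
  by apply: ereal_sup_ubound; exists 1 => //=.
apply: ge_ereal_sup => _ [d /= d0 <-].
apply/lee_addgt0Pr => e e0; rewrite add0e.
have [V [dV EV sV]] := H d d0 e e0.
by apply: (le_trans _ sV); apply: ereal_inf_lbound; exists V.
Qed.

Lemma small_cover_bigcup s d (F : nat -> set 'rV[R]_N) :
  (forall i eps, 0 < eps -> small_cover s d eps (F i)) ->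
  forall eps, 0 < eps -> small_cover s d eps (\bigcup_i F i).
Proof.
move=> H eps eps0.
have e0 i : 0 < eps / 2 * 2^-1 ^+ i by rewrite mulr_gt0 ?divr_gt0// exprn_gt0.
have [V VP] := choice (fun i => H i _ (e0 i)).
have [e [esurj eE]] := nat_pairing.
exists (fun k => V (e k).1 (e k).2); split.
- by move=> k; have [dV _ _] := VP (e k).1; exact: dV.
- move=> x [i _ Fx]; have [_ FV _] := VP i.
  have [j _ Vx] := FV x Fx.
  by have [k ek] := esurj (i, j); exists k => //; rewrite ek.
- rewrite (eE R (fun i j => hausdorff_weight s (V i j))); last first.
    by move=> i j; exact: hausdorff_weight_ge0.
  apply: (@le_trans _ _ (\sum_(0 <= i <oo) (eps / 2 * 2^-1 ^+ i)%:E)%E).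
    apply: lee_nneseries => i _; last by have [_ _] := VP i.
    by move=> _; apply: nneseries_ge0 => j _ _; exact: hausdorff_weight_ge0.
  apply: le_trans (nneseries_half_powers_le _) _; first by rewrite divr_ge0// ltW.
  by rewrite mulrC divfK.
Qed.

End Hausdorff.

(** * Upper bound on the dimension *)

Lemma hausdorff_weight_le (R : realType) (N : nat) (s d : R) (U : set 'rV[R]_N) :
  0 <= s -> 0 <= d -> (ediam U <= d%:E)%E ->
  (hausdorff_weight s U <= (d `^ s)%:E)%E.
Proof.
move=> s0 d0 Ud; rewrite /hausdorff_weight; case: ifP => _.
  by rewrite lee_fin powR_ge0.
have U0 := ediam_ge0 U.
have Ufin : ediam U \is a fin_num.
  by rewrite ge0_fin_numE// (le_lt_trans Ud)// ltry.
rewrite -(fineK Ufin) poweR_EFin lee_fin ge0_ler_powR// ?nnegrE ?fine_ge0//.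
by rewrite -lee_fin fineK.
Qed.

Lemma hausdorff_weight0 (R : realType) (N : nat) (s : R) :
  hausdorff_weight s (set0 : set 'rV[R]_N) = 0%E.
Proof. by rewrite /hausdorff_weight eqxx. Qed.

Lemma powR_expr (R : realType) (a s : R) (j : nat) : 0 <= a ->
  (a ^+ j) `^ s = (a `^ s) ^+ j.
Proof.
by move=> a0; rewrite -powR_mulrn// -powRrM mulrC powRrM powR_mulrn// powR_ge0.
Qed.

Lemma small_cover_seq (R : realType) (N : nat) (I : eqType) (s d b : R)
    (W : I -> set 'rV[R]_N) (l : seq I) : 0 <= d ->
  (forall c, (ediam (W c) <= d%:E)%E) ->
  (forall c, (hausdorff_weight s (W c) <= b%:E)%E) ->
  small_cover s d ((size l)%:R * b) [set x | exists2 c, c \in l & W c x].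
Proof.
move=> d0 dW wW; elim: l => [|c l [V [dV lV sV]]].
  exists (fun=> set0); split.
  - by move=> k; apply: ediam_le.
  - by move=> x [].
  - by rewrite eseries0 ?mul0r// => k _ _; exact: hausdorff_weight0.
exists (fun k => if k is k'.+1 then V k' else W c); split.
- by case=> [|k]; [exact: dW|exact: dV].
- move=> x [c']; rewrite inE => /orP[/eqP ->|c'l] Wx; first by exists 0%N.
  by have [|k _ Vk] := lV x; [exists c'|exists k.+1].
- rewrite /= -[_.+1%:R]natr1 mulrDl mul1r addrC EFinD.
  rewrite nneseries_recl//; last by move=> k _; exact: hausdorff_weight_ge0.
  apply: leeD => //; rewrite -(nneseries_addn 1); last first.
    by move=> k; exact: hausdorff_weight_ge0.
  by under eq_eseriesr do rewrite addn1.
Qed.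

Lemma int_shift_bounds (z : int) (J : nat) : - J%:Z <= z -> z < J%:Z ->
  0 <= z + J%:Z < (2 * J)%N%:Z.
Proof. by move=> ? ?; apply/andP; lia. Qed.

(** The cube is cut into (2 K 2^j)^N dyadic cubes of diameter at most N 2^-j, so the
    sum of the weights is O(2^((N - s) j)). *)
Lemma small_cover_cube (R : realType) (N : nat) (s d eps : R) (K : nat) :
  N%:R < s -> 0 < d -> 0 < eps ->
  small_cover s d eps [set x : 'rV[R]_N | forall i, `|x ord0 i| < K%:R].
Proof.
move=> Ns d0 eps0.
have s0 : 0 < s by apply: le_lt_trans Ns.
pose q : R := (2 `^ (s - N%:R))^-1.
have q1 : (1 : R) < 2 `^ (s - N%:R).
  have t0 : 0 < s - N%:R by rewrite subr_gt0.
  have := @gt0_ltr_powR R _ t0 1 2; rewrite powR1; apply; rewrite ?nnegrE ?ltr1n //. 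

have q01 : 0 <= q < 1.
  by rewrite /q invr_ge0 powR_ge0 invf_lt1//; apply: lt_trans q1.
pose C : R := (2 * K%:R) ^+ N * N%:R `^ s.
have C0 : 0 <= C by rewrite mulr_ge0 ?powR_ge0// exprn_ge0// mulr_ge0.
have [j1 Hj1] := expr_lt_eventually q01 (divr_gt0 eps0 (ltr_pwDl ltr01 C0)).
have h01 : 0 <= (2^-1 : R) < 1 by lra.
have [j2 Hj2] := expr_lt_eventually h01 (divr_gt0 d0 (ltr_pwDl ltr01 (ler0n R N))).
pose j := maxn j1 j2.
have qj : C * q ^+ j <= eps.
  have := Hj1 j (leq_maxl _ _); rewrite ltr_pdivlMr; last by lra.
  have : 0 <= q ^+ j by rewrite exprn_ge0//; case/andP: q01.
  by rewrite mulrDr mulr1 mulrC; lra.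
have dj : N%:R / 2 ^+ j <= d.
  have := Hj2 j (leq_maxr _ _); rewrite ltr_pdivlMr; last by rewrite ltr_pwDl.
  have : 0 <= (2^-1 : R) ^+ j by rewrite exprn_ge0.
  by rewrite exprVn mulrDr mulr1 mulrC; lra.
have p0 : (0 : R) < 2 ^+ j by rewrite exprn_gt0.
(* Cell coordinates lie between - K 2^j and K 2^j; W shifts them to start at 0. *)
pose M := (2 * K * 2 ^ j)%N.
pose W (c : {ffun 'I_N -> 'I_M}) : set 'rV[R]_N :=
  [set x | forall i, Num.floor (2 ^+ j * x ord0 i) = (c i)%:Z - (K * 2 ^ j)%:Z].
have dW c : (ediam (W c) <= (N%:R / 2 ^+ j)%:E)%E.
  apply: ediam_le; first by rewrite divr_ge0// ltW.
  move=> x y Wx Wy; apply: (le_trans (enorm_le_sum _)).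
  apply: (@le_trans _ _ (\sum_(i < N) (2 ^+ j)^-1)); last first.
    by rewrite big_const_ord iter_addr addr0 mulrC -[_ *+ N]mulr_natr.
  apply: ler_sum => i _; rewrite !mxE.
  rewrite -(ler_pM2l p0) divff ?gt_eqF// -{1}(gtr0_norm p0) -normrM mulrBr.
  have := floor_itv (2 ^+ j * x ord0 i); have := floor_itv (2 ^+ j * y ord0 i).
  rewrite Wx Wy intrD1 => /andP[? ?] /andP[? ?].
  by rewrite ler_norml; apply/andP; lra.
have wW c : (hausdorff_weight s (W c) <= ((N%:R / 2 ^+ j) `^ s)%:E)%E.
  apply: hausdorff_weight_le (dW c); first exact: ltW.
  by rewrite divr_ge0// ltW.
have [V [dV sub sV]] := @small_cover_seq R N _ s (N%:R / 2 ^+ j) _ W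
  (enum {ffun 'I_N -> 'I_M}) (divr_ge0 (ler0n _ _) (ltW p0)) dW wW.
exists V; split.
- by move=> k; apply: le_trans (dV k) _; rewrite lee_fin.
- move=> x Kx; apply: sub => /=.
  have bnd i : (0 <= Num.floor (2 ^+ j * x ord0 i) + (K * 2 ^ j)%:Z < M%:Z)%R.
    have := Kx i; rewrite ltr_norml => /andP[x1 x2].
    have l1 : (- (K * 2 ^ j)%:Z)%:~R <= 2 ^+ j * x ord0 i.
      by rewrite intrN -pmulrn natrM natrX mulrC -mulrN ler_pM2l// ltW.
    have l2 : 2 ^+ j * x ord0 i < ((K * 2 ^ j)%:Z)%:~R.
      by rewrite -pmulrn natrM natrX mulrC ltr_pM2r.
    have : (- (K * 2 ^ j)%:Z <= Num.floor (2 ^+ j * x ord0 i)).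
      by rewrite floor_ge_int.
    have : (Num.floor (2 ^+ j * x ord0 i) < (K * 2 ^ j)%:Z).
      by rewrite floor_lt_int.
    by rewrite /M -mulnA => ? ?; exact: int_shift_bounds.
  have cP i : (`|(Num.floor (2 ^+ j * x ord0 i) + (K * 2 ^ j)%:Z)%R|%N < M)%N.
    by have /andP[h1 h2] := bnd i; rewrite -ltz_nat gez0_abs.
  exists [ffun i => Ordinal (cP i)]; first by rewrite mem_enum.
  move=> i; rewrite ffunE /= gez0_abs; last by case/andP: (bnd i).
  by rewrite addrK.
- apply: (le_trans sV); rewrite lee_fin -cardE card_ffun !card_ord.
  apply: le_trans qj; rewrite le_eqVlt; apply/orP; left; apply/eqP.
  rewrite natrX /M !natrM natrX exprMn powRM// ?invr_ge0 ?ltW//.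
  rewrite -exprVn powR_expr ?invr_ge0// /C -!mulrA; congr (_ * _).
  rewrite mulrCA; congr (_ * _).
  rewrite -exprM mulnC exprM -exprMn; congr (_ ^+ _).
  rewrite /q -powR_inv1 // -powRrM mulN1r powRN -(@powR_mulrn _ 2)//.
  rewrite -powRN -powRD; last by rewrite pnatr_eq0 implybT.
  by rewrite -[in RHS]powRN opprB.
Qed.

Lemma hausdorff_null_above_dim (R : realType) (N : nat) (s : R) (E : set 'rV[R]_N) :
  N%:R < s -> hausdorff_measure s E = 0%E.
Proof.
move=> Ns; apply/hausdorff_null_small_cover => d d0 eps eps0.
have := small_cover_bigcup (fun K eps e0 => @small_cover_cube R N s d eps K Ns d0 e0).
move=> /(_ eps eps0) [V [dV cV sV]]; exists V; split => // x _; apply: cV.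
exists (Num.trunc (\sum_i `|x ord0 i|)).+1 => //= i.
apply: le_lt_trans (truncnS_gt _).
by rewrite (bigD1 i)//= lerDl sumr_ge0.
Qed.

(** * Dyadic cells of a Hausdorff null set *)

Fixpoint box (A : nat) (c : seq int) : seq (seq int) :=
  if c is x :: c' then
    [seq (x - A%:Z + k%:Z) :: d | k <- iota 0 (2 * A).+1, d <- box A c']
  else [:: [::]].

Lemma box_cons A x c : box A (x :: c) =
  [seq (x - A%:Z + k%:Z) :: d | k <- iota 0 (2 * A).+1, d <- box A c].
Proof. by []. Qed.

Lemma size_box A c : size (box A c) = ((2 * A).+1 ^ size c)%N.
Proof.
elim: c => [//|x c IH].
by rewrite box_cons size_allpairs size_iota IH -expnS.
Qed.

Lemma int_near_offset (A : nat) (x y : int) : `|y - x| <= A%:Z ->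
  exists2 k, (k < (2 * A).+1)%N & y = x - A%:Z + k%:Z.
Proof.
rewrite ler_norml => /andP[? ?]; exists (absz (y - x + A%:Z)); first by lia.
by rewrite gez0_abs; lia.
Qed.

Lemma mem_box A c d : size c = size d ->
  (forall k, (k < size c)%N -> `|nth 0 d k - nth 0 c k| <= A%:Z) -> d \in box A c.
Proof.
elim: c d => [|x c IH] [|y d] // [sz] H.
have [k kA yE] := int_near_offset (H 0%N isT); rewrite /= in yE.
rewrite box_cons yE; apply: allpairs_f; first by rewrite mem_iota add0n.
by apply: IH => // i ic; exact: (H i.+1).
Qed.

Lemma floor_dist_le (R : realType) (x y C : R) : `|x - y| <= C ->
  `|Num.floor x - Num.floor y| <= (Num.trunc C).+2%:Z.
Proof.
move=> xyC; have C1 := truncnS_gt C.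
have := floor_itv x; have := floor_itv y; rewrite !intrD1.
move: xyC; rewrite ler_norml => /andP[? ?] /andP[? ?] /andP[? ?].
rewrite ler_norml -!(ler_int R) intrN !intrB -pmulrn -[(_.+2)%:R]natr1.
by apply/andP; lra.
Qed.

Lemma dyadic_scale (R : realType) (d : R) (l : nat) : 0 < d <= (2^-1) ^+ l ->
  exists j, [/\ (l <= j)%N, d <= (2^-1) ^+ j & (2^-1) ^+ j.+1 < d].
Proof.
move=> /andP[d0 dl].
have h01 : 0 <= (2^-1 : R) < 1 by lra.
have [j0 H] := expr_lt_eventually h01 d0.
have ex : exists j, (2^-1 : R) ^+ j.+1 < d by exists j0; exact: H.
case: (ex_minnP ex) => j jd jmin; exists j; split => //.
  rewrite leqNgt; apply/negP => jl.
  have : (2^-1 : R) ^+ l <= (2^-1) ^+ j.+1 by rewrite ler_wiXn2l//; lra.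
  by rewrite leNgt (lt_le_trans jd).
case: j jd jmin => [|j] jd jmin.
  by rewrite expr0 (le_trans dl)// exprn_ile1//; lra.
by rewrite leNgt; apply/negP => /jmin; rewrite ltnn.
Qed.

Section Cells.
Variables (R : realType) (N m : nat) (T : 'rV[R]_N -> seq R) (C : R).
Hypotheses (C0 : 0 <= C) (sizeT : forall p, size (T p) = m).
Hypothesis lipT : forall p q k, `|nth 0 (T p) k - nth 0 (T q) k| <= C * enorm (p - q).

Let A := (Num.trunc C).+2.

(** The image under T of a set of diameter at most 2^-j meets a bounded number of
    cells of scale j. *)
Lemma set_cells (U : set 'rV[R]_N) (j : nat) :
  (ediam U <= ((2^-1) ^+ j)%:E)%E ->
  exists Ls : seq (seq int), (size Ls <= (2 * A).+1 ^ m)%N /\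
    forall p, U p -> cell j (T p) \in Ls.
Proof.
move=> Uj; have [->|/set0P[p0 Up0]] := eqVneq U set0.
  by exists [::].
exists (box A (cell j (T p0))); split.
  by rewrite size_box size_map sizeT.
move=> p Up; apply: mem_box; first by rewrite !size_map !sizeT.
move=> k; rewrite size_map sizeT => km.
rewrite !(nth_map 0) ?sizeT//; apply: floor_dist_le.
have p20 : (0 : R) < 2 ^+ j by rewrite exprn_gt0.
rewrite -mulrBr normrM gtr0_norm//.
have h : enorm (p - p0) <= (2^-1) ^+ j.
  by rewrite -lee_fin; apply: le_trans Uj; exact: enorm_le_ediam.
apply: (@le_trans _ _ (2 ^+ j * (C * (2^-1) ^+ j))).
  rewrite ler_pM2l//; apply: (le_trans (lipT _ _ _)); exact: ler_wpM2l.
by rewrite mulrCA exprVn divff ?mulr1// gt_eqF.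
Qed.

(** The scale j is adapted to the diameter d of U.  If d > 0, choose 2^-j comparable
    with d, so that 2^(-s1 j) is comparable with d^s1 <= d^s; if d = 0, any j that
    makes 2^(-s1 j) smaller than eta will do. *)
Lemma set_scaled_cells (s s1 eta : R) (U : set 'rV[R]_N) (l : nat) :
  0 <= s -> s <= s1 -> 0 < s1 -> 0 < eta -> (ediam U <= ((2^-1) ^+ l)%:E)%E ->
  exists (jL : nat * seq (seq int)), [/\ (l <= jL.1)%N,
    forall p, U p -> cell jL.1 (T p) \in jL.2 &
    (((size jL.2)%:R * (2 `^ (- s1)) ^+ jL.1)%:E <=
      (((2 * A).+1 ^ m)%:R * 2 `^ s1)%:E * (hausdorff_weight s U + eta%:E))%E].
Proof.
move=> s0 ss1 s10 eta0 Ul.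
pose theta : R := 2 `^ (- s1).
have th0 : 0 <= theta by exact: powR_ge0.
have t2 : (1 : R) < 2 `^ s1.
  by have := @gt0_ltr_powR R _ s10 1 2; rewrite powR1; apply; rewrite ?nnegrE ?ltr1n.
have thE : theta = (2 `^ s1)^-1 by rewrite /theta powRN.
have th1 : theta < 1 by rewrite thE invf_lt1//; lra.
have w0 := hausdorff_weight_ge0 s U.
have B0 : 0 <= ((2 * A).+1 ^ m)%:R * 2 `^ s1 :> R by rewrite mulr_ge0// powR_ge0.
have [U0|Un0] := eqVneq U set0.
  exists (l, [::]); split => //=; first by rewrite U0.
  by rewrite mul0r mule_ge0// adde_ge0// lee_fin ltW.
suff [j [lj Uj tj]] : exists j, [/\ (l <= j)%N, (ediam U <= ((2^-1) ^+ j)%:E)%E &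
    ((theta ^+ j)%:E <= (2 `^ s1)%:E * (hausdorff_weight s U + eta%:E))%E].
  have [Ls [szL inL]] := set_cells Uj.
  exists (j, Ls); split => //=; rewrite EFinM.
  rewrite (EFinM ((2 * A).+1 ^ m)%:R) -muleA; apply: lee_pmul => //.
  by rewrite lee_fin ler_nat.
have U0 := ediam_ge0 U.
have Ufin : ediam U \is a fin_num.
  by rewrite ge0_fin_numE// (le_lt_trans Ul)// ltry.
pose d := fine (ediam U).
have dE : ediam U = d%:E by rewrite fineK.
have d0 : 0 <= d by rewrite fine_ge0.
have wE : hausdorff_weight s U = (d `^ s)%:E.
  by rewrite /hausdorff_weight (negbTE Un0) dE poweR_EFin.
rewrite dE lee_fin in Ul.
have [dp|dn] := ltP 0 d.
  have [|j [lj dj djS]] := @dyadic_scale R d l; first by rewrite dp.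
  exists j; split => //; first by rewrite dE lee_fin.
  rewrite wE -EFinD -EFinM lee_fin mulrDr.
  apply: (@le_trans _ _ (2 `^ s1 * d `^ s)); last first.
    by rewrite lerDl mulr_ge0// ltW// (lt_trans _ t2).
  have d1 : d <= 1 by rewrite (le_trans dj)// exprn_ile1//; lra.
  apply: (@le_trans _ _ (2 `^ s1 * d `^ s1)); last first.
    rewrite ler_pM2l; last by lra.
    by apply: ger_powR => //; rewrite dp.
  apply: (@le_trans _ _ (2 `^ s1 * ((2^-1) ^+ j.+1) `^ s1)).
    rewrite powR_expr ?invr_ge0// -powR_inv1// -powRrM mulN1r -/theta exprS.
    by rewrite mulrA thE divff ?mul1r//; lra.
  rewrite ler_pM2l; last by lra.
  by apply: ge0_ler_powR; rewrite ?nnegrE ?exprn_ge0 ?ltW.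
have th01 : 0 <= theta < 1 by rewrite th0.
have [j0 H] := expr_lt_eventually th01 eta0.
exists (maxn l j0); split; first exact: leq_maxl.
  rewrite dE lee_fin (le_trans dn)// exprn_ge0//.
apply: (@le_trans _ _ (1 * eta%:E)%E).
  by rewrite mul1e lee_fin ltW// H// leq_maxr.
have e1 : (eta%:E <= hausdorff_weight s U + eta%:E)%E by rewrite leeDr.
have e2 : (1 <= (2 `^ s1)%:E)%E by rewrite lee_fin ltW.
by apply: lee_pmul => //; rewrite lee_fin ltW.
Qed.

(** For each l, cover E by sets of diameter at most 2^-l and of total weight at most
    2^-l, and replace each of them by cells of scale at least l.  All these cells
    together have a finite budget, and each point of E is covered once for each l,
    hence at arbitrarily large scales.  Replacing s by a larger s1 makes the exponent
    positive, as needed to choose the scale of a set reduced to one point. *)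
Lemma hausdorff_null_cells (s s1 : R) (E : set 'rV[R]_N) :
  0 <= s -> s <= s1 -> 0 < s1 -> hausdorff_measure s E = 0%E ->
  exists sc L, (budget (2 `^ (- s1) : R) sc L < +oo)%E /\
    forall p, E p -> frequently_in sc L (T p).
Proof.
move=> s0 ss1 s10 /hausdorff_null_small_cover HE.
have h0 l : 0 < (2^-1 : R) ^+ l by rewrite exprn_gt0.
have [V VP] := choice (fun l => HE _ (h0 l) _ (h0 l)).
have P (lk : nat * nat) := set_scaled_cells s0 ss1 s10 (mulr_gt0 (h0 lk.1) (h0 lk.2))
   (let: And3 dV _ _ := VP lk.1 in dV lk.2).
have [F FP] := choice P.
have [e [esurj eE]] := nat_pairing.
exists (fun n => (F (e n)).1), (fun n => (F (e n)).2); split.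
  rewrite /budget.
  pose B : R := ((2 * A).+1 ^ m)%:R * 2 `^ s1.
  have B0 : 0 <= B by rewrite mulr_ge0// powR_ge0.
  pose a i j : \bar R := ((size (F (i, j)).2)%:R * (2 `^ (- s1)) ^+ (F (i, j)).1)%:E.
  have a0 i j : (0 <= a i j)%E by rewrite lee_fin mulr_ge0// exprn_ge0// powR_ge0.
  rewrite (eq_eseriesr (g := fun k => a (e k).1 (e k).2)); last first.
    by move=> k _; rewrite /a -surjective_pairing.
  rewrite (eE R a a0).
  apply: (@le_lt_trans _ _ (\sum_(0 <= i <oo) (3 * B * 2^-1 ^+ i)%:E)%E); last first.
    apply: (le_lt_trans (nneseries_half_powers_le _)); last exact: ltry.
    by rewrite mulr_ge0.
  apply: lee_nneseries => i _; first by move=> _; exact: nneseries_ge0.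
  apply: (@le_trans _ _ (\sum_(0 <= j <oo) B%:E * (hausdorff_weight s (V i j) +
      (2^-1 ^+ i * 2^-1 ^+ j)%:E))%E).
    apply: lee_nneseries => j _; first by move=> _; exact: a0.
    by have [_ _] := FP (i, j).
  have w0 j : (0 <= hausdorff_weight s (V i j))%E by exact: hausdorff_weight_ge0.
  have h2 j : (0 <= (2^-1 ^+ i * 2^-1 ^+ j : R)%:E)%E.
    by rewrite lee_fin ltW// mulr_gt0.
  rewrite nneseriesZl; last by move=> j _; rewrite adde_ge0.
  rewrite nneseriesD//.
  have -> : (3 * B * 2^-1 ^+ i)%:E = (B%:E * ((2^-1 ^+ i)%:E + (2 * 2^-1 ^+ i)%:E))%E.
    by rewrite -EFinD -EFinM; congr (_%:E); ring.
  apply: lee_wpmul2l; first by rewrite lee_fin.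
  apply: leeD; first by have [_ _] := VP i.
  by apply: nneseries_half_powers_le; exact: ltW.
move=> p Ep l; have [_ EV _] := VP l.
have [k _ Vp] := EV p Ep; have [n en] := esurj (l, k).
have [lj inL _] := FP (l, k).
by exists n; rewrite en; split => //; exact: inL.
Qed.

End Cells.

(** * Locally flat sets *)

Lemma open_line (R : realType) (N : nat) (O : set 'rV[R]_N) (q v : 'rV[R]_N) :
  open O -> O q -> exists2 t : R, t != 0 & O (q + t *: v).
Proof.
move=> oO Oq.
have c : (fun t : R => q + t *: v) @ (0 : R) --> q.
  rewrite -[X in _ --> X]addr0 -(scale0r v).
  apply: cvgD; first exact: cvg_cst.
  by apply: cvgZr_tmp; exact: cvg_id.
have : \forall t \near (0 : R), O (q + t *: v).
  by apply: c; exact: open_nbhs_nbhs.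
move=> /nbhs_ballP [e /= e0 H].
exists (e / 2); first by rewrite gt_eqF// divr_gt0.
by apply: H; rewrite /ball /= sub0r normrN gtr0_norm ?divr_gt0// ltr_pdivrMr//; lra.
Qed.

(** A direction of P can be shortened so that it stays in O; it is then a direction of
    P', and directions are stable under scaling. *)
Lemma affine_subspace_local_sub (R : realType) (N d d' : nat)
    (P P' O : set 'rV[R]_N) (q : 'rV[R]_N) :
  affine_subspace d P -> affine_subspace d' P' -> open O -> O q ->
  P q -> P' q -> P `&` O `<=` P' -> P `<=` P'.
Proof.
move=> [a [V [_ ->]]] [a' [V' [_ ->]]] oO Oq [v0 v0V qE] [v0' v0V' qE'] sub.
have VV' w : w \in V -> w \in V'.
  move=> wV; have [t t0 Ot] := open_line w oO Oq.
  have [|z zV' zE] := sub (q + t *: w).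
    split => //; exists (v0 + t *: w); last by rewrite addrA qE.
    by rewrite /= memvD// memvZ.
  have : t *: w \in V'.
    have -> : t *: w = z - v0'.
      by apply: (addrI q); rewrite -zE -qE' addrACA subrr addr0.
    by rewrite memvB.
  by rewrite rpredZeq (negbTE t0).
move=> _ [v vV <-]; exists (v - v0 + v0').
  by rewrite /= memvD// VV'// memvB.
rewrite addrC -addrA [v0' + _]addrC qE' -qE.
by rewrite [a + v0]addrC addrA subrK addrC.
Qed.

(** The points near which M coincides with a fixed affine subspace P0 form a set that
    is open in M, and also closed in M because two affine subspaces that coincide near
    a point are equal.  As M is connected, this set is M. *)
Lemma locally_flat_linear (R : realType) (N d : nat) (M : set 'rV[R]_N) :
  connected M -> M !=set0 ->
  (forall p, M p -> exists V P, [/\ open V, V p, affine_subspace d P &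
     M `&` V = P `&` V]) ->
  linear_set M.
Proof.
move=> cM [p0 Mp0] flat.
have [V0 [P0 [oV0 V0p0 aP0 MP0]]] := flat p0 Mp0.
pose good (V : set 'rV[R]_N) := open V /\ M `&` V = P0 `&` V.
pose O := \bigcup_(V in good) V.
have oO : open O by apply: bigcup_open => V [].
have MO : M `&` O = P0 `&` O.
  apply/seteqP; split => x [Mx [V gV Vx]]; (split; last by exists V);
    have [_ /seteqP[s1 s2]] := gV.
    by have [] := s1 x (conj Mx Vx).
  by have [] := s2 x (conj Mx Vx).
have closedO : M `&` closure (M `&` O) `<=` O.
  move=> q [Mq cq]; have [V [P [oV Vq aP MP]]] := flat q Mq.
  have [q' [[Mq' [V' [oV' MV'] V'q']] Vq']] := cq V (open_nbhs_nbhs (conj oV Vq)).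
  exists V => //; split => //; rewrite MP.
  have sMP : M `&` V `<=>` P `&` V by apply/seteqP.
  have sMP0 : M `&` V' `<=>` P0 `&` V' by apply/seteqP.
  have oVV' : open (V `&` V') by exact: openI.
  have Pq' : P q' by have [] := sMP.1 q' (conj Mq' Vq').
  have P0q' : P0 q' by have [] := sMP0.1 q' (conj Mq' V'q').
  suff -> : P = P0 by [].
  apply/seteqP; split.
    apply: (affine_subspace_local_sub aP aP0 oVV' (conj Vq' V'q')) => // x [Px [Vx V'x]].
    have [Mx _] := sMP.2 x (conj Px Vx).
    by have [] := sMP0.1 x (conj Mx V'x).
  apply: (affine_subspace_local_sub aP0 aP oVV' (conj Vq' V'q')) => // x [Px [Vx V'x]].
  have [Mx _] := sMP0.2 x (conj Px V'x).
  by have [] := sMP.1 x (conj Mx Vx).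
have ME : M `&` O = M.
  apply: cM.
  - by exists p0; split => //; exists V0.
  - by exists O.
  - exists (closure (M `&` O)); first exact: closed_closure.
    apply/seteqP; split => x [Mx Ox].
      by split => //; apply: subset_closure.
    by split => //; apply: closedO.
by exists d, P0, O; split => //; rewrite -MO.
Qed.

(** * Differentiation along a segment *)

Lemma is_derive_entry (R : realType) (n a b : nat) (F : 'rV[R]_n -> 'M[R]_(a, b))
    (y v : 'rV[R]_n) (u : R) i j : differentiable F (y + u *: v) ->
  is_derive u (1 : R) (fun t => F (y + t *: v) i j) ('D_v F (y + u *: v) i j).
Proof.
move=> dF; have /derivableP [cF _] := @diff_derivable _ _ _ _ _ v dF.
have cv : (fun h : R => h^-1 *: ((fun t => F (y + t *: v) i j) (h *: 1 + u) -
    F (y + u *: v) i j)) @ 0^' --> 'D_v F (y + u *: v) i j.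
  have -> : (fun h : R => h^-1 *: ((fun t => F (y + t *: v) i j) (h *: 1 + u) -
      F (y + u *: v) i j)) =
    (fun M : 'M[R]_(a, b) => M i j) \o
      (fun h : R => h^-1 *: ((F \o shift (y + u *: v)) (h *: v) - F (y + u *: v))).
    apply/funext => h /=; rewrite !mxE.
    have -> : h *: (1 : R) = h by exact: mulr1.
    by rewrite scalerDl addrCA.
  by apply: cvg_comp; [exact: cF|exact: coord_continuous].
by split; [apply/cvg_ex; eexists; exact: cv|exact: cvg_lim cv].
Qed.

Lemma is_derive_along (R : realType) (n : nat) (f : 'rV[R]_n -> 'rV[R]_1)
    (y v : 'rV[R]_n) (u : R) : differentiable f (y + u *: v) ->
  is_derive u (1 : R) (fun t => f (y + t *: v) ord0 ord0)
    ((v *m jacobian f (y + u *: v)) ord0 ord0).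
Proof.
move=> df; rewrite -deriveEjacobian//; exact: is_derive_entry.
Qed.

Lemma derivable_jacobian_along (R : realType) (n : nat) (f : 'rV[R]_n -> 'rV[R]_1)
    (y v : 'rV[R]_n) (u : R) : differentiable (jacobian f) (y + u *: v) ->
  derivable (fun t : R => (v *m jacobian f (y + t *: v)) ord0 ord0) u (1 : R).
Proof.
move=> dJ.
have -> : (fun t : R => (v *m jacobian f (y + t *: v)) ord0 ord0) =
    \sum_(i < n) (v ord0 i \*: (fun t : R => jacobian f (y + t *: v) i ord0)).
  by apply/funext => t; rewrite mxE fct_sumE.
apply: derivable_sum => i; apply: derivableZ.
by have [] := is_derive_entry i ord0 dJ.
Qed.

Lemma constant_derive_chord (R : realType) (al be : R) (f f1 : R -> R) :
  al < 0 -> 1 < be ->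
  (forall u, al < u < be -> is_derive u (1 : R) f (f1 u)) ->
  (forall u v, al < u < be -> al < v < be -> f1 u = f1 v) ->
  forall t, 0 <= t <= 1 -> f t = f 0 + t * (f 1 - f 0).
Proof.
move=> al0 be1 df cst.
have slope t : 0 <= t <= 1 -> f t - f 0 = f1 0 * t.
  move=> /andP[t0 t1]; have [->|tn0] := eqVneq t 0; first by rewrite subrr mulr0.
  have tp : 0 < t by rewrite lt_neqAle eq_sym tn0.
  have dft x : x \in `]0, t[ -> is_derive x (1 : R) f (f1 x).
    by rewrite in_itv /= => /andP[? ?]; apply: df; apply/andP; lra.
  have cf : {within `[0, t], continuous f}.
    apply: derivable_within_continuous => x; rewrite in_itv /= => /andP[? ?].
    have xi : al < x < be by apply/andP; lra.
    by have [] := df x xi.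
  have [c] := MVT tp dft cf.
  rewrite in_itv /= subr0 => /andP[? ?] ->; congr (_ * _).
  by apply: cst; apply/andP; lra.
move=> t t01; have e1 := slope t t01; have e2 : f 1 - f 0 = f1 0 * 1.
  by apply: slope; rewrite ler01 lexx.
by rewrite e2 mulr1 [t * _]mulrC -e1 addrC subrK.
Qed.

(** If f is affine along the segment from x0 to x0 + v, its increment is its derivative
    at x0 in the direction v. *)
Lemma affine_rays_jacobian (R : realType) (n : nat) (f : 'rV[R]_n -> 'rV[R]_1)
    (x0 v : 'rV[R]_n) : differentiable f x0 ->
  (forall t, 0 <= t <= 1 -> f (x0 + t *: v) ord0 ord0 =
     f x0 ord0 ord0 + t * (f (x0 + v) ord0 ord0 - f x0 ord0 ord0)) ->
  f (x0 + v) = f x0 + v *m jacobian f x0.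
Proof.
move=> df lin.
have : is_derive (0 : R) (1 : R) (fun t => f (x0 + t *: v) ord0 ord0)
    ((v *m jacobian f x0) ord0 ord0).
  by have := @is_derive_along R n f x0 v 0; rewrite scale0r addr0; exact.
set D := (v *m _) ord0 ord0; set K := f (x0 + v) ord0 ord0 - f x0 ord0 ord0 in lin.
move=> dD.
suff KD : K = D.
  apply/rowP => j; rewrite !ord1 !mxE; move: KD; rewrite /D /K mxE => <-.
  by rewrite addrC subrK.
apply/eqP; rewrite -subr_eq0 -normr_le0; apply/ler_addgt0Pr => e e0; rewrite add0r.
have [d d0 H] := derivable_approx dD e0.
(* On the segment the increment is exactly linear, so one point close to x0
   suffices to compare it with the derivative. *)
pose h := Num.min (d / 2) 1.
have h0 : 0 < h by rewrite lt_min divr_gt0// ltr01.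
have hd : h < d by rewrite gt_min; apply/orP; left; rewrite ltr_pdivrMr//; lra.
have h1 : h <= 1 by rewrite ge_min lexx orbT.
have /= := H h; rewrite subr0 gtr0_norm// => /(_ hd).
rewrite (lin h); last by rewrite ltW.
rewrite scale0r addr0 [X in `|X| <= _](_ : _ = h * (K - D)); last by ring.
rewrite normrM gtr0_norm//.
by rewrite [leRHS]mulrC ler_pM2l.
Qed.

(** * Charts *)

Lemma row_continuous_at (R : realType) (T : topologicalType) (N : nat)
    (F : T -> 'rV[R]_N) (x : T) :
  (forall j, {for x, continuous (fun t => F t ord0 j)}) -> {for x, continuous F}.
Proof.
move=> cF A /nbhs_ballP [e /= e0 eA].
have : \forall t \near x, forall j, ball (F x ord0 j) e (F t ord0 j).
  apply: filter_forall => j.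
  by apply: (cF j); exact: nbhsx_ballx.
apply: filterS => t Ht; apply: eA; split => // i j; rewrite !ord1; exact: Ht.
Qed.

Lemma row_mulmx_continuous_at (R : realType) (T : topologicalType) (m N : nat)
    (F : T -> 'rV[R]_m) (B : 'M[R]_(m, N)) (x : T) :
  {for x, continuous F} -> {for x, continuous (fun t => F t *m B)}.
Proof.
move=> cF; apply: row_continuous_at => j.
have -> : (fun t => (F t *m B) ord0 j) =
    (fun t => \sum_k (F t ord0 k * B k j)).
  by apply/funext => t; rewrite mxE.
apply: cvg_big => [|k _]; first exact: add_continuous.
apply: cvgM; last exact: cvg_cst.
by apply: (@continuous_comp _ _ _ F (fun M : 'rV[R]_m => M ord0 k)) => //;
  exact: coord_continuous.
Qed.

Lemma row_mx_graph_continuous_at (R : realType) (n k : nat)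
    (f : 'rV[R]_n -> 'rV[R]_k) (x : 'rV[R]_n) :
  {for x, continuous f} -> {for x, continuous (fun t => row_mx t (f t))}.
Proof.
move=> cf; apply: row_continuous_at => j; case: (split_ordP j) => i ->.
  have -> : (fun t => row_mx t (f t) ord0 (lshift k i)) =
      (fun M : 'rV[R]_n => M ord0 i).
    by apply/funext => t; rewrite row_mxEl.
  exact: coord_continuous.
have -> : (fun t => row_mx t (f t) ord0 (rshift n i)) = (fun t => f t ord0 i).
  by apply/funext => t; rewrite row_mxEr.
by apply: (@continuous_comp _ _ _ f (fun M : 'rV[R]_k => M ord0 i)) => //;
  exact: coord_continuous.
Qed.

(** The point of the space with coordinates (x, z) in the frame of a chart. *)
Definition graph_point (R : realType) (n : nat) (Q : 'M[R]_(n + 1))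
    (c : 'rV[R]_(n + 1)) (x : 'rV[R]_n) (z : 'rV[R]_1) : 'rV[R]_(n + 1) :=
  row_mx x z *m Q + c.

Lemma chart_graph_point (R : realType) (n : nat) (Q : 'M[R]_(n + 1)) c x z :
  Q *m Q^T = 1%:M -> (graph_point Q c x z - c) *m Q^T = row_mx x z.
Proof. by move=> QQ; rewrite /graph_point addrK -mulmxA QQ mulmx1. Qed.

(** The neighbourhood V is shrunk so that the part of M in V is exactly the part in V of
    the graph over a ball around x0, and V projects into that ball. *)
Lemma graph_chart (R : realType) (n : nat) (M : set 'rV[R]_(n + 1)) p :
  twice_differentiable_set M -> M p ->
  exists (V : set 'rV[R]_(n + 1)) (Q : 'M[R]_(n + 1)) (c : 'rV[R]_(n + 1))
      (f : 'rV[R]_n -> 'rV[R]_1) (x0 : 'rV[R]_n) (r : R),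
    [/\ [/\ open V, V p, Q *m Q^T = 1%:M & 0 < r], p = graph_point Q c x0 (f x0),
      twice_differentiable_on [set x | `|x - x0| < r] f,
      (forall x, `|x - x0| < r -> M (graph_point Q c x (f x))) &
      (forall q, V q -> `|lsubmx ((q - c) *m Q^T) - x0| < r /\
        (M q <-> exists2 x, `|x - x0| < r & q = graph_point Q c x (f x)))].
Proof.
move=> tM Mp; have [V [g [U [f [[oV Vp] [Q [c [QQ gE]]] oU fU MV]]]]] := tM p Mp.
have gG x : g (row_mx x (f x)) = graph_point Q c x (f x) by rewrite gE.
have [[_ [x0 Ux0 <-] pE] _] : ((g @` graph_over U f) `&` V) p by rewrite -MV.
rewrite gG in pE.
have cG : {for x0, continuous (fun x => graph_point Q c x (f x))}.
  have c1 : {for x0, continuous (fun x => row_mx x (f x) *m Q)}.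
    apply: row_mulmx_continuous_at; apply: row_mx_graph_continuous_at.
    exact: differentiable_continuous (fU x0 Ux0).1.
  apply: (continuousD c1 (_ : {for x0, continuous (fun=> c)})).
  exact: cst_continuous.
have : \forall x \near x0, U x /\ V (graph_point Q c x (f x)).
  apply: filterI; first exact: open_nbhs_nbhs.
  by apply: cG; apply: open_nbhs_nbhs; rewrite pE.
move=> /nbhs_ballP [r /= r0 rUV].
have {}rUV x : `|x - x0| < r -> U x /\ V (graph_point Q c x (f x)).
  by move=> xr; apply: rUV; rewrite -ball_normE /ball_ /= distrC.
pose l (q : 'rV[R]_(n + 1)) : 'rV[R]_n := lsubmx ((q - c) *m Q^T).
have lG x : l (graph_point Q c x (f x)) = x.
  by rewrite /l chart_graph_point// row_mxKl.
have cl : continuous l.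
  move=> q; apply: continuous_comp; last exact: continuous_lsubmx.
  apply: row_mulmx_continuous_at.
  apply: (continuousB (_ : {for q, continuous (fun q => q)})
    (_ : {for q, continuous (fun=> c)})).
    exact: cvg_id.
  exact: cst_continuous.
exists (V `&` l @^-1` (ball x0 r)), Q, c, f, x0, r; split => //.
- split => //.
    apply: openI => //; apply: open_comp; last exact: ball_open.
    by move=> q _; exact: cl.
  by split => //; rewrite /= -pE lG; exact: ballxx.
- by move=> x xr; apply: fU; have [] := rUV x xr.
- move=> x xr; have [Ux Vx] := rUV x xr.
  have [] // : (M `&` V) (graph_point Q c x (f x)).
  rewrite MV; split => //; exists (row_mx x (f x)); last exact: gG.
  by exists x.
- move=> q [Vq lq]; split.
    by move: lq; rewrite /= -ball_normE /ball_ /= distrC.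
  split.
    move=> Mq; have : (M `&` V) q by [].
    rewrite MV => -[[_ [x Ux <-] qE] _]; exists x; last by rewrite -gG.
    move: lq; rewrite /= -qE gG lG -ball_normE /ball_ /=.
    by rewrite distrC.
  move=> [x xr ->]; have [Ux Vx] := rUV x xr.
  have [] // : (M `&` V) (graph_point Q c x (f x)).
  rewrite MV; split => //; exists (row_mx x (f x)); last exact: gG.
  by exists x.
Qed.

Lemma tangent_hyperplane_affine (R : realType) (n : nat) (Q : 'M[R]_(n + 1)) c
    (x0 : 'rV[R]_n) (z0 : 'rV[R]_1) (L : 'M[R]_(n, 1)) : Q *m Q^T = 1%:M ->
  affine_subspace n
    [set graph_point Q c (x0 + w) (z0 + w *m L) | w in [set: 'rV[R]_n]].
Proof.
move=> QQ.
pose B : 'M[R]_(n, n + 1) := row_mx 1%:M L *m Q.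
have BE w : w *m B = row_mx w (w *m L) *m Q.
  by rewrite /B mulmxA mul_mx_row mulmx1.
have Binj w : w *m B = 0 -> w = 0.
  rewrite BE => /(congr1 (mulmx^~ Q^T)); rewrite -mulmxA QQ mulmx1 mul0mx.
  by rewrite -row_mx0 => /eq_row_mx [].
pose F := linfun (mulmxr B : 'rV[R]_n -> 'rV[R]_(n + 1)).
have FE w : F w = w *m B by rewrite lfunE.
exists (graph_point Q c x0 z0), (limg F); split.
  have := limg_ker_dim F fullv.
  have -> : lker F = 0%VS.
    apply/eqP/lker0P => x y; rewrite !FE => e.
    by apply/subr0_eq/Binj; rewrite mulmxBl e subrr.
  by rewrite capv0 dimv0 add0n dimvf /dim /= mul1n.
apply/seteqP; split => q [w wP <-].
  exists (F w); first by rewrite /= memv_img// memvf.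
  rewrite FE BE /graph_point -add_row_mx mulmxDl -!addrA; congr (_ + _).
  by rewrite addrC.
have /memv_imgP [w' _ ->] := wP; exists w' => //.
rewrite FE BE /graph_point -add_row_mx mulmxDl -!addrA; congr (_ + _).
by rewrite addrC.
Qed.

(** Otherwise, in every chart, f is affine along all the rays from x0, so that its graph
    is the tangent hyperplane and M is locally flat. *)
Lemma nonlinear_chart (R : realType) (n : nat) (M : set 'rV[R]_(n + 1)) :
  hypersurface M -> twice_differentiable_set M -> ~ linear_set M ->
  exists (Q : 'M[R]_(n + 1)) (c : 'rV[R]_(n + 1)) (f : 'rV[R]_n -> 'rV[R]_1)
      (x0 v : 'rV[R]_n) (r t : R),
    [/\ Q *m Q^T = 1%:M,
      twice_differentiable_on [set x | `|x - x0| < r] f,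
      (forall x, `|x - x0| < r -> M (graph_point Q c x (f x))),
      `|v| < r /\ 0 <= t <= 1 &
      f (x0 + t *: v) ord0 ord0 !=
        f x0 ord0 ord0 + t * (f (x0 + v) ord0 ord0 - f x0 ord0 ord0)].
Proof.
move=> [cM _] tM nlM; apply: contrapT => H; apply: nlM.
have [->|/set0P M0] := eqVneq M set0.
  exists 0%N, [set 0 + v | v in [set v | v \in (0%VS : {vspace 'rV[R]_(n + 1)})]], set0.
  split; [|exact: open0|by rewrite setI0].
  by exists 0, 0%VS; split => //; rewrite dimv0.
apply: (@locally_flat_linear R (n + 1) n M cM M0) => p Mp.
have [V [Q [c [f [x0 [r [[oV Vp QQ r0] pE fd MG MV]]]]]]] := graph_chart tM Mp.
have x0r : `|x0 - x0| < r by rewrite subrr normr0.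
have aff v : `|v| < r -> f (x0 + v) = f x0 + v *m jacobian f x0.
  move=> vr; apply: affine_rays_jacobian; first exact: (fd x0 x0r).1.
  move=> t t01; apply: contrapT => ne; apply: H.
  by exists Q, c, f, x0, v, r, t; split => //; exact/eqP.
exists V, [set graph_point Q c (x0 + w) (f x0 + w *m jacobian f x0)
  | w in [set: 'rV[R]_n]].
split => //; first exact: tangent_hyperplane_affine.
apply/seteqP; split => q [hq Vq]; split => //; have [lq Mq] := MV q Vq.
  have [x xr ->] := Mq.1 hq; exists (x - x0) => //.
  by rewrite -aff// addrC subrK.
case: hq lq => w _ <-; rewrite chart_graph_point// row_mxKl addrAC subrr add0r => wr.
by rewrite -aff//; apply: MG; rewrite addrAC subrr add0r.
Qed.

(** * Planes that cut the hyperplanes *)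

(** A plane and a subspace of dimension n intersect nontrivially in a space of
    dimension n + 1. *)
Lemma hyperplane_meets_plane (R : realType) (n : nat) (H : set 'rV[R]_(n + 1))
    (p e1 e2 : 'rV[R]_(n + 1)) : hyperplane H -> H p -> free [:: e1; e2] ->
  exists d1 d2 : R, (d1 != 0) || (d2 != 0) /\
    forall t, H (p + t *: (d1 *: e1 + d2 *: e2)).
Proof.
move=> [a [W [dW ->]]] [w0 w0W <-] fr.
pose S := <<[:: e1; e2]>>%VS.
have dS : \dim S = 2 by move: fr; rewrite /free => /eqP.
have : (0 < \dim (S :&: W))%N.
  have := dimv_sum_cap S W; rewrite dS dW.
  have : (\dim (S + W) <= n + 1)%N.
    by rewrite (leq_trans (dimvS (subvf _)))// dimvf /dim /= mul1n.
  by move=> h1 h2; rewrite lt0n; apply/eqP => h3; move: h2; rewrite h3; lia.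
rewrite lt0n dimv_eq0 -vpick0 => pn0.
have := memv_pick (S :&: W); set w := vpick _ in pn0 *.
rewrite memv_cap /S span_cons span_seq1 => /andP[+ wW].
move=> /memv_addP [w1 /vlineP [d1 ->] [w2 /vlineP[d2 ->] wE]].
exists d1, d2; split.
  apply/negPn/negP; rewrite negb_or !negbK => /andP[/eqP d10 /eqP d20].
  by move: pn0; rewrite wE d10 d20 !scale0r addr0 eqxx.
move=> t; exists (w0 + t *: w); last by rewrite addrA wE.
by rewrite /= memvD// memvZ.
Qed.

Lemma free_plane (R : realType) (n : nat) (Q : 'M[R]_(n + 1)) (v : 'rV[R]_n) :
  Q *m Q^T = 1%:M -> v != 0 ->
  free [:: row_mx v (0 : 'rV[R]_1) *m Q; row_mx (0 : 'rV[R]_n) (1%:M : 'M[R]_1) *m Q].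
Proof.
move=> QQ v0.
have inj (a b : 'rV[R]_(n + 1)) : a *m Q = b *m Q -> a = b.
  by move=> /(congr1 (mulmx^~ Q^T)); rewrite -!mulmxA QQ !mulmx1.
rewrite free_cons seq1_free span_seq1; apply/andP; split.
  apply/negP => /vlineP [k]; rewrite scalemxAl => /inj.
  rewrite scale_row_mx scaler0 => /eq_row_mx [e _].
  by rewrite e eqxx in v0.
apply/eqP => e; have /inj : row_mx (0 : 'rV[R]_n) (1%:M : 'M[R]_1) *m Q = 0 *m Q.
  by rewrite mul0mx.
rewrite -row_mx0 => /eq_row_mx [_ /matrixP /(_ ord0 ord0)].
by rewrite !mxE eqxx => /eqP; rewrite oner_eq0.
Qed.

(** Coordinates adapted to the family of planes that are parallel to v and to the
    vertical axis of the chart: u is the position along v, measured by the coordinate i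
    (on which v does not vanish), the remaining horizontal coordinates js tell which
    plane contains the point, and the last entry is the height.  The two coordinates
    of the planes come last, as slices are taken from the head of the list. *)
Definition slice_coords (R : realType) (n : nat) (Q : 'M[R]_(n + 1)) c
    (x0 v : 'rV[R]_n) (i : 'I_n) (js : seq 'I_n) (p : 'rV[R]_(n + 1)) : seq R :=
  let q := (p - c) *m Q^T in
  let u := (lsubmx q ord0 i - x0 ord0 i) / v ord0 i in
  [seq lsubmx q ord0 j - u * v ord0 j | j <- js] ++ [:: u; rsubmx q ord0 ord0].

Lemma slice_coords_lipschitz (R : realType) (n : nat) (Q : 'M[R]_(n + 1)) c
    (x0 v : 'rV[R]_n) (i : 'I_n) (js : seq 'I_n) :
  exists2 C, 0 <= C & forall p q k,
    `|nth 0 (slice_coords Q c x0 v i js p) k -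
      nth 0 (slice_coords Q c x0 v i js q) k| <= C * enorm (p - q).
Proof.
pose S := \sum_b \sum_a `|Q^T b a|.
have S0 : 0 <= S by apply: sumr_ge0 => b _; apply: sumr_ge0.
pose Tv := \sum_j `|v ord0 j|.
have T0 : 0 <= Tv by apply: sumr_ge0.
pose I := `|v ord0 i|^-1.
have I0 : 0 <= I by rewrite invr_ge0.
have co p q a : `|((p - c) *m Q^T) ord0 a - ((q - c) *m Q^T) ord0 a| <= S * enorm (p - q).
  have -> : ((p - c) *m Q^T) ord0 a - ((q - c) *m Q^T) ord0 a = ((p - q) *m Q^T) ord0 a.
    have -> : p - q = (p - c) - (q - c) by rewrite opprB addrA subrK.
    by rewrite [in RHS]mulmxBl !mxE.
  rewrite mxE (le_trans (ler_norm_sum _ _ _))// mulr_suml; apply: ler_sum => b _.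
  rewrite normrM mulrC; apply: ler_pM => //; last exact: coord_le_enorm.
  by rewrite (bigD1 a)//= lerDl sumr_ge0.
exists (S + S * I + S * I * Tv).
  by rewrite !addr_ge0// !mulr_ge0.
move=> p q k; rewrite /slice_coords.
have e0 := enorm_ge0 (p - q).
set p' := (p - c) *m Q^T; set q' := (q - c) *m Q^T.
set up := (lsubmx p' ord0 i - _) / _; set uq := (lsubmx q' ord0 i - _) / _.
have u_le : `|up - uq| <= S * I * enorm (p - q).
  rewrite /up /uq -mulrBl normrM normfV mulrAC ler_wpM2r//.
  rewrite opprB addrA subrK [lsubmx p' _ _]mxE [lsubmx q' _ _]mxE; exact: co.
have l1 : 0 <= S * enorm (p - q) by rewrite mulr_ge0.
have l2 : 0 <= S * I * enorm (p - q) by rewrite !mulr_ge0.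
have l3 : 0 <= S * I * Tv * enorm (p - q) by rewrite !mulr_ge0.
rewrite !mulrDl.
have [kj|kj] := ltnP k (size js).
  rewrite !nth_cat !size_map kj !(nth_map i)//; set j := nth i js k.
  have -> : lsubmx p' ord0 j - up * v ord0 j - (lsubmx q' ord0 j - uq * v ord0 j) =
    (lsubmx p' ord0 j - lsubmx q' ord0 j) - (up - uq) * v ord0 j by ring.
  rewrite (le_trans (ler_normB _ _))// normrM.
  have : `|lsubmx p' ord0 j - lsubmx q' ord0 j| <= S * enorm (p - q).
    by rewrite [lsubmx p' _ _]mxE [lsubmx q' _ _]mxE; exact: co.
  have vT : `|v ord0 j| <= Tv by rewrite /Tv (bigD1 j)//= lerDl sumr_ge0.
  have : `|up - uq| * `|v ord0 j| <= S * I * Tv * enorm (p - q).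
    by rewrite mulrAC; apply: ler_pM.
  by lra.
rewrite !nth_cat !size_map ltnNge kj /=.
case: (k - size js)%N => [|[|m]] /=.
- by move: u_le; lra.
- have : `|rsubmx p' ord0 ord0 - rsubmx q' ord0 ord0| <= S * enorm (p - q).
    by rewrite [rsubmx p' _ _]mxE [rsubmx q' _ _]mxE; exact: co.
  by lra.
- by rewrite nth_nil subrr normr0; lra.
Qed.

(** * Dimension of the union *)

Lemma slice_coords_graph_point (R : realType) (n : nat) (Q : 'M[R]_(n + 1)) c
    (x0 v y : 'rV[R]_n) (i : 'I_n) (js : seq 'I_n) (u : R) (z : 'rV[R]_1) :
  Q *m Q^T = 1%:M -> v ord0 i != 0 -> y ord0 i = x0 ord0 i ->
  slice_coords Q c x0 v i js (graph_point Q c (y + u *: v) z) =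
    [seq y ord0 j | j <- js] ++ [:: u; z ord0 ord0].
Proof.
move=> QQ vi yi; rewrite /slice_coords chart_graph_point// row_mxKl row_mxKr.
have -> : ((y + u *: v) ord0 i - x0 ord0 i) / v ord0 i = u.
  by rewrite !mxE yi addrAC subrr add0r mulfK.
congr (_ ++ _); apply: eq_map => j.
by rewrite !mxE addrK.
Qed.

Lemma graph_point_translate (R : realType) (n : nat) (Q : 'M[R]_(n + 1)) c
    (y v : 'rV[R]_n) (z : 'rV[R]_1) (u tau d1 d2 : R) :
  graph_point Q c (y + u *: v) z + tau *: (d1 *: (row_mx v (0 : 'rV[R]_1) *m Q) +
    d2 *: (row_mx (0 : 'rV[R]_n) (1%:M : 'M[R]_1) *m Q)) =
  graph_point Q c (y + (u + tau * d1) *: v) (z + (tau * d2)%:M).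
Proof.
rewrite /graph_point addrAC; congr (_ + _).
rewrite scalerDr !scalerA !scalemxAl -!mulmxDl; congr (_ *m Q).
rewrite !scale_row_mx !add_row_mx !scaler0 addr0 add0r; congr (row_mx _ _).
  by rewrite scalerDl addrA.
by rewrite scalemx1.
Qed.

Lemma row_fill (R : realType) (n : nat) (x0 : 'rV[R]_n) (i : 'I_n) (js : seq 'I_n)
    (ys : seq R) (rho : R) : uniq js -> js =i predC1 i -> 0 < rho ->
  size ys = size js ->
  (forall k, `|nth 0 ys k - nth 0 [seq x0 ord0 j | j <- js] k| < rho) ->
  exists y : 'rV[R]_n, [/\ y ord0 i = x0 ord0 i, [seq y ord0 j | j <- js] = ys &
    `|y - x0| < rho].
Proof.
move=> ujs jsE rho0 sz near.
pose y : 'rV[R]_n := \row_j (if j == i then x0 ord0 i else nth 0 ys (index j js)).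
exists y; split.
- by rewrite mxE eqxx.
- apply: (@eq_from_nth _ 0); rewrite size_map// => k kj.
  rewrite (nth_map i)// mxE ifF; last first.
    by apply/negbTE; have := mem_nth i kj; rewrite jsE.
  by rewrite index_uniq.
- have : ball x0 rho y.
    split => // a j; rewrite ord1 /ball /= mxE; case: eqP => [->|/eqP ji].
      by rewrite subrr normr0.
    have jj : j \in js by rewrite jsE.
    have := near (index j js); rewrite (nth_map i) ?index_mem// nth_index//.
    by rewrite distrC.
  by rewrite -ball_normE /ball_ /= distrC.
Qed.

(** The two sides of the inequality depend continuously on the base point. *)
Lemma chord_defect_stable (R : realType) (n : nat) (f : 'rV[R]_n -> 'rV[R]_1)
    (x0 v : 'rV[R]_n) (r t : R) :
  (forall x, `|x - x0| < r -> differentiable f x) -> `|v| < r -> 0 <= t <= 1 ->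
  f (x0 + t *: v) ord0 ord0 !=
    f x0 ord0 ord0 + t * (f (x0 + v) ord0 ord0 - f x0 ord0 ord0) ->
  exists2 rho, 0 < rho & forall y, `|y - x0| < rho ->
    f (y + t *: v) ord0 ord0 !=
      f y ord0 ord0 + t * (f (y + v) ord0 ord0 - f y ord0 ord0).
Proof.
move=> df vr /andP[t0 t1] ne.
have shiftc w : `|w| < r -> {for x0, continuous (fun y : 'rV[R]_n => f (y + w) ord0 ord0)}.
  move=> wr; apply: (@continuous_comp _ _ _ (fun y : 'rV[R]_n => f (y + w))
    (fun M : 'rV[R]_1 => M ord0 ord0)); last exact: coord_continuous.
  apply: (@continuous_comp _ _ _ (fun y : 'rV[R]_n => y + w) f).
    apply: (continuousD (_ : {for x0, continuous (fun y : 'rV[R]_n => y)})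
      (_ : {for x0, continuous (fun _ : 'rV[R]_n => w)})).
      exact: cvg_id.
    exact: cst_continuous.
  by apply: differentiable_continuous; apply: df; rewrite addrAC subrr add0r.
pose phi (y : 'rV[R]_n) := f (y + t *: v) ord0 ord0 -
  (f (y + 0) ord0 ord0 + t * (f (y + v) ord0 ord0 - f (y + 0) ord0 ord0)).
have r0 : 0 < r by apply: le_lt_trans vr.
have c0 : {for x0, continuous (fun y : 'rV[R]_n => f (y + 0) ord0 ord0)}.
  by apply: shiftc; rewrite normr0.
have cphi : {for x0, continuous phi}.
  apply: continuousB.
    apply: shiftc; rewrite normrZ ger0_norm//; apply: le_lt_trans vr.
    by rewrite -[leRHS]mul1r ler_wpM2r.
  apply: continuousD => //; apply: continuousM; first exact: cst_continuous.
  by apply: continuousB => //; exact: shiftc.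
have phi0 : phi x0 != 0 by rewrite /phi addr0 subr_eq0.
have nz : nbhs (phi x0) [set z : R | z != 0].
  by apply: open_nbhs_nbhs; split => //; exact: open_neq.
have /nbhs_ballP [rho /= rho0 H] := cphi _ nz; exists rho => // y yr.
have := H y; rewrite -ball_normE /ball_ /= distrC => /(_ yr).
by rewrite /phi addr0 subr_eq0.
Qed.

(** The parameter theta = 2^-s of a family of cells of exponent s < n + 1 becomes, after
    n - 1 slices, the parameter of a family of exponent smaller than 2. *)
Lemma slice_exponent (R : realType) (n : nat) (s : R) : (0 < n)%N ->
  s < (n + 1)%:R -> 4^-1 < 2 ^+ n.-1 * 2 `^ (- s) :> R.
Proof.
case: n => // n _ sn.
have e : 2 ^+ n = 4^-1 * 2 `^ ((n.+1 + 1)%:R) :> R.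
  by rewrite powR_mulrn// addn1 !exprS; field.
rewrite e -mulrA -powRD; last by rewrite pnatr_eq0 implybT.
rewrite -[ltLHS]mulr1 ltr_pM2l ?invr_gt0//.
have s0 : 0 < (n.+1 + 1)%:R - s by rewrite subr_gt0.
by have := @gt0_ltr_powR R _ s0 1 2; rewrite powR1; apply; rewrite ?nnegrE ?ltr1n.
Qed.

(** Slice the cells of [hausdorff_null_cells] along the coordinates js, near the point
    x0.  The plane obtained contains the part of the graph of f above the
    segment from y to y + v, for some y close to x0.  By [curve_not_coverable] f is
    affine along this segment, which [chord_defect_stable] excludes. *)
Theorem hyperplane_cover_not_null (R : realType) (n : nat)
    (A : set (set 'rV[R]_(n + 1))) (Q : 'M[R]_(n + 1)) (c : 'rV[R]_(n + 1))
    (f : 'rV[R]_n -> 'rV[R]_1) (x0 v : 'rV[R]_n) (r t s : R) :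
  Q *m Q^T = 1%:M -> twice_differentiable_on [set x | `|x - x0| < r] f ->
  (forall H, A H -> hyperplane H) ->
  (forall x, `|x - x0| < r -> exists2 H, A H & H (graph_point Q c x (f x))) ->
  `|v| < r -> 0 <= t <= 1 ->
  f (x0 + t *: v) ord0 ord0 !=
    f x0 ord0 ord0 + t * (f (x0 + v) ord0 ord0 - f x0 ord0 ord0) ->
  0 <= s -> s < (n + 1)%:R ->
  hausdorff_measure s (\bigcup_(H in A) H) <> 0%E.
Proof.
move=> QQ fd hA cov vr t01 ne s0 sn Hs.
have v0 : v != 0.
  by apply: contraNneq ne => ->; rewrite scaler0 !addr0 subrr mulr0 addr0.
have /rV0Pn [i vi] := v0.
have n0 : (0 < n)%N by exact: leq_ltn_trans (leq0n i) (ltn_ord i).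
pose js := rem i (enum 'I_n).
have ujs : uniq js by rewrite rem_uniq// enum_uniq.
have jsE : js =i predC1 i.
  by move=> j; rewrite mem_rem_uniq ?enum_uniq// !inE mem_enum andbT.
have szjs : size js = n.-1 by rewrite size_rem ?mem_enum// size_enum_ord.
(* As 0 < n, the exponent 1 is also smaller than n + 1. *)
pose s1 := Num.max s 1.
have ss1 : s <= s1 by rewrite le_max lexx.
have s10 : 0 < s1 by rewrite lt_max ltr01 orbT.
have s1n : s1 < (n + 1)%:R.
  by rewrite gt_max sn /= ltr1n addn1 ltnS.
have [C C0 lip] := slice_coords_lipschitz Q c x0 v i js.
have szT p : size (slice_coords Q c x0 v i js p) = (size js + 2)%N.
  by rewrite size_cat size_map.
have [sc [L [bL frL]]] := hausdorff_null_cells C0 szT lip s0 ss1 s10 Hs.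
have dfr x : `|x - x0| < r -> differentiable f x by move=> /fd [].
have [rho2 rho20 Hne] := chord_defect_stable dfr vr t01 ne.
(* The excess r - |v| is shared between the displacement of the base point and
   the two ends of the segment, which is prolonged to contain [0, 1] in its
   interior. *)
pose eta := (r - `|v|) / 3.
have eta0 : 0 < eta by rewrite divr_gt0// subr_gt0.
pose rho := Num.min rho2 eta.
have rho0 : 0 < rho by rewrite lt_min rho20.
have [ys [L' [szy near bL' frL']]] :=
  slices_budget [seq x0 ord0 j | j <- js] (powR_ge0 _ _) rho0 bL.
rewrite size_map in szy bL'.
have [y [yi yys yx0]] := row_fill ujs jsE rho0 szy near.
have ye : `|y - x0| < eta by apply: lt_le_trans yx0 _; rewrite ge_min lexx orbT.
have yr2 : `|y - x0| < rho2 by apply: lt_le_trans yx0 _; rewrite ge_min lexx.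
pose eps := eta / (`|v| + 1).
have v1 : 0 < `|v| + 1 by rewrite ltr_wpDl.
have eps0 : 0 < eps by rewrite divr_gt0.
have epsv : eps * `|v| <= eta.
  by rewrite /eps mulrAC ler_pdivrMr// ler_pM2l// lerDl.
have inball u : - eps < u < 1 + eps -> `|y + u *: v - x0| < r.
  move=> /andP[u1 u2].
  have : `|u| <= 1 + eps by rewrite ler_norml; apply/andP; lra.
  move=> /(ler_wpM2r (normr_ge0 v)); rewrite mulrDl mul1r -normrZ => h.
  rewrite addrAC (le_lt_trans (ler_normD _ _))//.
  have : eta * 3 = r - `|v| by rewrite /eta divfK.
  by move: h epsv ye; lra.
have dphi u : - eps < u < 1 + eps -> is_derive u (1 : R)
    (fun u => f (y + u *: v) ord0 ord0)
    ((v *m jacobian f (y + u *: v)) ord0 ord0).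
  by move=> /inball /fd [? _]; exact: is_derive_along.
have cst : forall a b : R, - eps < a < 1 + eps -> - eps < b < 1 + eps ->
    (v *m jacobian f (y + a *: v)) ord0 ord0 =
    (v *m jacobian f (y + b *: v)) ord0 ord0.
  apply: (@curve_not_coverable R _ (- eps) (1 + eps) sc L'
    (fun u => f (y + u *: v) ord0 ord0)
    (fun u => (v *m jacobian f (y + u *: v)) ord0 ord0) _ bL') => //.
  - by rewrite szjs; exact: slice_exponent.
  - by move=> u /inball /fd [_ ?]; exact: derivable_jacobian_along.
  - move=> u /inball ur; have [H AH Hp] := cov _ ur.
    have [d1 [d2 [d12 Hd]]] :=
      hyperplane_meets_plane (hA H AH) Hp (free_plane QQ v0).
    exists d1, d2; split => // tau.
    have := frL _ (ex_intro2 _ _ H AH (Hd tau)).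
    rewrite graph_point_translate slice_coords_graph_point// yys => /frL'.
    by rewrite !mxE eqxx mulr1n.
have e0 : - eps < 0 by lra.
have e1 : 1 < 1 + eps by lra.
have := constant_derive_chord e0 e1 dphi cst t01.
by move=> /eqP; rewrite scale0r addr0 scale1r; apply/negP; exact: Hne.
Qed.

Theorem theorem3p2p2 (R : realType) (n : nat) (M : set 'rV[R]_(n + 1))
    (A : set (set 'rV[R]_(n + 1)))
    (hM : hypersurface M) (hM2 : twice_differentiable_set M)
    (hMnl : ~ linear_set M)
    (hA : forall H, A H -> hyperplane H)
    (hcov : M `<=` \bigcup_(H in A) H) :
  hausdorff_dim (\bigcup_(H in A) H) = ((n + 1)%:R)%:E.
Proof.
apply/eqP; rewrite eq_le; apply/andP; split.
  apply/lee_addgt0Pr => e e0; apply: ereal_inf_lbound => /=.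
  exists ((n + 1)%:R + e); last by rewrite EFinD.
  split; first by rewrite addr_ge0// ltW.
  by apply: hausdorff_null_above_dim; rewrite ltrDl.
apply: le_ereal_inf_tmp => _ [s [s0 Hs] <-]; rewrite lee_fin leNgt; apply/negP => sn.
have [Q [c [f [x0 [v [r [t [QQ fd MG [vr t01] ne]]]]]]]] := nonlinear_chart hM hM2 hMnl.
apply: (hyperplane_cover_not_null QQ fd hA _ vr t01 ne s0 sn Hs) => x xr.
exact: hcov (MG x xr).
Qed.
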